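(* Let $\{W_k\}_{k\ge1}$ be i.i.d. random variables with finite moments of every order, $\mathbb{E}[W_1]=0$, $\mathbb{E}[W_1^2]=1$, and $\kappa_r(W_1)\ne0$ for all $r=2,\dots,q+1$, where $q\ge2$. Let $$F_n=\sum_{k\ge1}\alpha_{n,k}W_k\quad(n\in\mathbb{N}),\qquad F_\infty=\sum_{k=1}^q\alpha_{\infty,k}W_k,$$ where $\{\alpha_{n,k}\}_{n,k\ge1}\subset\mathbb{R}$, the real numbers $\alpha_{\infty,1},\dots,\alpha_{\infty,q}$ are non-zero and pairwise distinct, and $\sum_{k\ge1}\alpha_{n,k}^2=1$ for every $n$ and $\sum_{k=1}^q\alpha_{\infty,k}^2=1$. Let $\Delta(F_n)=\sum_{k\ge1}\alpha_{n,k}^2\prod_{r=1}^q(\alpha_{n,k}-\alpha_{\infty,r})^2$. Then there is a constant $C>0$ depending only on the target $F_\infty$ (hence independent of $n$) such that $$d_{\mathbf{W}_2}(F_n,F_\infty)\le C\left(\sqrt{\Delta(F_n)}+\sum_{r=2}^{q+1}|\kappa_r(F_n)-\kappa_r(F_\infty)|\right)\qquad\text{for all } n\ge1.$$ More precisely, there exist a threshold $U_\infty>0$ and a constant $C>0$, depending only on the target $F_\infty$ (hence independent of $n$), such that the bound $$\sqrt{\Delta(F_n)}+\sum_{r=2}^{q+1}|\kappa_r(F_n)-\kappa_r(F_\infty)|\le U_\infty$$ implies $$d_{\mathbf{W}_2}(F_n,F_\infty)\le C\sqrt{\Delta(F_n)}.$$ In particular, if $\Delta(F_n)\to0$ and $\kappa_r(F_n)\to\kappa_r(F_\infty)$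 for all $r=2,\dots,q+1$ as $n\to\infty$, then the threshold requirement holds (for all sufficiently large $n$), and therefore $F_n$ converges in distribution to $F_\infty$ at rate $\sqrt{\Delta(F_n)}$ (that is, $d_{\mathbf{W}_2}(F_n,F_\infty)\le C\sqrt{\Delta(F_n)}$ for all sufficiently large $n$).
   Context: $\kappa_r(\cdot)$ denotes the $r$-th cumulant. $d_{\mathbf{W}_2}(F,G)$ is the Wasserstein distance of order 2 between the laws of real square-integrable random variables $F$ and $G$: $d_{\mathbf{W}_2}(F,G)=\big(\inf\mathbb{E}|X-Y|^2\big)^{1/2}$, the infimum being over all pairs $(X,Y)$ of random variables on a common probability space with $X$ distributed as $F$ and $Y$ distributed as $G$. The (possibly infinite) series defining $F_n$ converges in $L^2$. *)

(* Defs.v *)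
From HB Require Import structures.
From mathcomp Require Import all_boot all_order all_algebra.
From mathcomp Require Import all_classical all_reals all_analysis.

Set Implicit Arguments.
Unset Strict Implicit.
Unset Printing Implicit Defensive.

Import Order.TTheory GRing.Theory Num.Theory.
Import numFieldNormedType.Exports.

Local Open Scope classical_set_scope.
Local Open Scope ring_scope.

Section cumulants.
Context {d : measure_display} {T : measurableType d} {R : realType}.
Variables (P : probability T R) (X : T -> R).

Definition moment (j : nat) : R := fine 'E_P[fun w => (X w ^+ j)%R].

Definition mgf_tail (r : nat) : {poly R} :=
  \poly_(j < r.+1) (if j == 0%N then 0 else moment j / j`!%:R).

(* [cumulant r] is r! times the coefficient of t^r in the formal power series
   log E[exp(t X)], where log (1 + u) = \sum_(k >= 1) (-1)^(k-1) u^k / k and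
   u = \sum_(j >= 1) E[X^j] t^j / j!. Since u has no constant term, both series
   can be truncated at order r without changing that coefficient.
   Meaningful only if X has finite moments up to order r. *)
Definition cumulant (r : nat) : R :=
  r`!%:R *
  (\sum_(1 <= k < r.+1) ((-1) ^+ k.-1 / k%:R) *: mgf_tail r ^+ k)`_r.

End cumulants.

Definition same_law {R : realType} {d1 d2 : measure_display}
    {T1 : measurableType d1} {T2 : measurableType d2}
    {P1 : probability T1 R} {P2 : probability T2 R}
    (X : {RV P1 >-> R}) (Y : {RV P2 >-> R}) : Prop :=
  forall A : set R, measurable A -> distribution P1 X A = distribution P2 Y A.

(* [F] and [G] may live on different probability spaces, and the coupling
   [(X, Y)] ranges over all probability spaces. *)
Definition wasserstein2 {R : realType} {d1 d2 : measure_display}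
    {T1 : measurableType d1} {T2 : measurableType d2}
    {P1 : probability T1 R} {P2 : probability T2 R}
    (F : {RV P1 >-> R}) (G : {RV P2 >-> R}) : \bar R :=
  sqrte (ereal_inf [set e : \bar R |
    exists (d : measure_display) (T : measurableType d) (Q : probability T R)
           (X Y : {RV Q >-> R}),
      [/\ same_law X F, same_law Y G &
          e = 'E_Q[fun w => (`|X w - Y w| ^+ 2)%R]%E]]).

Section sequences_of_random_variables.
Context {R : realType} {d : measure_display} {T : measurableType d}.
Context {P : probability T R}.

Definition mutually_independent (W : nat -> {RV P >-> R}) : Prop :=
  forall (s : seq nat) (B : nat -> set R), uniq s ->
    (forall k, k \in s -> measurable (B k)) ->
    P (\bigcap_(k in [set` s]) W k @^-1` B k) =
      (\prod_(k <- s) P (W k @^-1` B k))%E.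

Definition iid_with_law (mu : probability (measurableTypeR R) R)
    (W : nat -> {RV P >-> R}) : Prop :=
  mutually_independent W /\
  forall (k : nat) (A : set R), measurable A -> distribution P (W k) A = mu A.

Definition L2_sum (X : nat -> {RV P >-> R}) (F : {RV P >-> R}) : Prop :=
  'E_P[fun w => ((F w - \sum_(0 <= k < N) X k w) ^+ 2)%R]%E @[N --> \oo] --> 0%E.

Definition cvg_in_distribution (F : nat -> {RV P >-> R}) (G : {RV P >-> R})
    : Prop :=
  forall x : R, {for x, continuous (cdf G)} ->
    cdf (F n) x @[n --> \oo] --> cdf G x.

End sequences_of_random_variables.

Definition Delta {R : realType} (q : nat) (aoo : 'I_q -> R) (a : R^nat) : R :=
  limn (series (fun k => a k ^+ 2 * \prod_(r < q) (a k - aoo r) ^+ 2)).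

(* Main.v *)
(* Each coefficient of F_n is compared with the points 0, aoo_1, ..., aoo_q:
   since Delta vanishes only there, rounding every alpha_k to the nearest such
   point b_k costs sum_k (alpha_k - b_k)^2 <= c Delta(F_n).  The cumulants
   kappa_r(F_n) = kappa_r(W) sum_k alpha_k^r, r = 2..q+1, give q approximate
   linear equations for the number of k rounded to each aoo_i; the system is of
   Vandermonde type and its solution for F_oo is (1, ..., 1), so below the
   threshold these integers are all equal to 1.  The rounded sum then has the
   law of F_oo and couples F_n with F_oo at squared distance c Delta(F_n).
   Above the threshold the trivial bound d_W2 <= 2 suffices. *)
Require Import Defs.
From HB Require Import structures.
From mathcomp Require Import all_boot all_order all_algebra.
From mathcomp Require Import all_classical all_reals all_analysis.
From mathcomp Require Import measurable_realfun.
From mathcomp Require Import ring lra zify.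

Set Implicit Arguments.
Unset Strict Implicit.
Unset Printing Implicit Defensive.

Import Order.TTheory GRing.Theory Num.Theory.
Import numFieldNormedType.Exports.

Local Open Scope classical_set_scope.
Local Open Scope ring_scope.

(** * Truncated formal logarithm *)

(** The costly input is the identity between cumulants and power sums. Cumulants are coefficients of
    a formal logarithm, so their additivity is proved on truncated polynomials, with no exponential
    moment. For infinite sums, L2 convergence by itself controls only moments up to order 2; bounds
    on every moment of the partial sums, uniform in their length, supply the rest, and they hold
    because the [W_k] are centred and the squared coefficients sum to at most 1. In the counting
    step, the error made by rounding a power must be summable over infinitely many coefficients. It
    is at most a constant times |alpha_k| |alpha_k - b_k|, which AM-GM splits between
    [sum_k alpha_k^2 = 1] and Delta. The counts being integers, an error less than 1 determines them
    exactly; this is why the cumulants leave no trace in the rate below the threshold. *)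

(* [low_zero N p]: [p] vanishes modulo X^N. *)
Definition low_zero (K : nzRingType) (N : nat) (p : {poly K}) :=
  forall i, (i < N)%N -> p`_i = 0.

Section low_zero.
Variable K : comNzRingType.
Implicit Types p q : {poly K}.

Lemma low_zeroD N p q : low_zero N p -> low_zero N q -> low_zero N (p + q).
Proof. by move=> hp hq i iN; rewrite coefD hp ?hq ?addr0. Qed.

Lemma low_zeroM m n p q :
  low_zero m p -> low_zero n q -> low_zero (m + n) (p * q).
Proof.
move=> hp hq i imn; rewrite coefM big1// => -[j /= jlt] _.
have [jm|mj] := ltnP j m; first by rewrite hp ?mul0r.
by rewrite hq ?mulr0//; lia.
Qed.

Lemma low_zeroMl N p q : low_zero N q -> low_zero N (p * q).
Proof. by move=> hq; rewrite -[N]add0n; apply: low_zeroM. Qed.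

Lemma low_zeroX p n : p`_0 = 0 -> low_zero n (p ^+ n).
Proof.
move=> p0; elim: n => [|n ih]; first by [].
rewrite exprS -add1n; apply: low_zeroM => //.
by case.
Qed.

Lemma low_zero_cancel N p q : p`_0 = 1 -> low_zero N (p * q) -> low_zero N q.
Proof.
move=> p0 hpq; elim/ltn_ind => i ih iN.
have := hpq _ iN; rewrite coefM big_ord_recl p0 mul1r subn0 big1 ?addr0//.
by move=> [j /= jlt] _; rewrite ih ?mulr0// /bump /=; lia.
Qed.

Lemma low_zero_subX N p q n : low_zero N (p - q) -> low_zero N (p ^+ n - q ^+ n).
Proof. by move=> h; rewrite subrXX mulrC; apply: low_zeroMl. Qed.

End low_zero.

Definition log1p_trunc (K : fieldType) (N : nat) (u : {poly K}) : {poly K} :=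
  \sum_(1 <= k < N.+1) ((-1) ^+ k.-1 / k%:R) *: u ^+ k.

Section log1p_trunc.
Variable K : numFieldType.
Implicit Types u v w : {poly K}.

(** The derivative is a geometric sum in [- u] times that of [u], and [1 + u] telescopes it. The
    identity is exact; the last term is the price of truncation, of order at least [N] when [u] has
    no constant term. *)
Lemma deriv_log1p_trunc N u :
  (1 + u) * (log1p_trunc N u)^`() = u^`() - (- u) ^+ N * u^`().
Proof.
have -> : (log1p_trunc N u)^`() = (\sum_(i < N) (- u) ^+ i) * u^`().
  rewrite /log1p_trunc big_add1 /= big_mkord raddf_sum /= mulr_suml.
  apply: eq_bigr => i _.
  rewrite derivZ deriv_exp /= -[X in _ *: X]scaler_nat scalerA divfK ?pnatr_eq0//.
  by rewrite [u^`() * _]mulrC scalerAl -[- u]scaleN1r exprZn.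
have -> : 1 + u = - (- u - 1) by rewrite opprB opprK.
by rewrite mulrA mulNr -subrX1 opprB mulrBl mul1r.
Qed.

Lemma log1p_trunc_eqmod M N u v :
  low_zero M (u - v) -> low_zero M (log1p_trunc N u - log1p_trunc N v).
Proof.
move=> huv i iM; rewrite /log1p_trunc -sumrB coef_sum big1// => k _.
by rewrite -scalerBr coefZ (low_zero_subX _ huv)  ?mulr0.
Qed.

(* Multiplied by the unit [(1 + u) * (1 + v)], the derivatives of both sides agree
   modulo X^N, because [(1 + u) * log(1 + u)' = u']. *)
Lemma log1p_truncM N u v w : u`_0 = 0 -> v`_0 = 0 ->
  low_zero N.+1 ((1 + w) - (1 + u) * (1 + v)) -> (0 < N)%N ->
  (log1p_trunc N w)`_N = (log1p_trunc N u)`_N + (log1p_trunc N v)`_N.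
Proof.
move=> u0 v0 huvw N0.
pose z := (1 + u) * (1 + v) - 1.
have z0 : z`_0 = 0.
  rewrite /z coefB coef0M !coefD !coef1 u0 v0 /=; ring.
have zE : 1 + z = (1 + u) * (1 + v) by rewrite /z; ring.
have -> : (log1p_trunc N w)`_N = (log1p_trunc N z)`_N.
  apply/eqP; rewrite -subr_eq0 -coefB (@log1p_trunc_eqmod N.+1)//.
  by have -> : w - z = (1 + w) - (1 + u) * (1 + v) by rewrite /z; ring.
pose L := log1p_trunc N z - (log1p_trunc N u + log1p_trunc N v).
(* In characteristic 0 the coefficient of order [N] of [L] is read off that of order [N - 1] of its
   derivative. *)
suff : low_zero N L^`().
  move=> /(_ N.-1); rewrite coef_deriv prednK// => /(_ (leqnn _)) /eqP.
  by rewrite mulrn_eq0 -leqn0 leqNgt N0 /L coefB coefD subr_eq0 => /eqP.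
apply: (@low_zero_cancel _ _ (1 + z)); first by rewrite coefD coef1 z0 addr0.
have tail (x : {poly K}) : x`_0 = 0 -> low_zero N ((- x) ^+ N * x^`()).
  move=> x0; rewrite mulrC; apply: low_zeroMl; apply: low_zeroX.
  by rewrite coefN x0 oppr0.
(* The main terms cancel by the product rule; only the three truncation remainders survive. *)
have -> : (1 + z) * L^`() =
    - ((- z) ^+ N * z^`()) + (1 + v) * ((- u) ^+ N * u^`())
    + (1 + u) * ((- v) ^+ N * v^`()).
  have dz : z^`() = (1 + v) * u^`() + (1 + u) * v^`().
    by rewrite /z derivB derivM !derivD -polyC1 !derivC; ring.
  rewrite /L derivB derivD mulrBr deriv_log1p_trunc mulrDr zE.
  rewrite [(1 + u) * (1 + v) * (log1p_trunc N u)^`()]mulrAC.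
  rewrite -[(1 + u) * (1 + v) * _]mulrA !deriv_log1p_trunc dz; ring.
by do 2?apply: low_zeroD; [rewrite -mulN1r|..]; apply: low_zeroMl; exact: tail.
Qed.

(** Substituting [a X] for X commutes with the logarithm; this is the source of the factor [a ^+ r]
    in the cumulant of a multiple. *)
Lemma log1p_trunc_scale N a u v : (forall i, v`_i = a ^+ i * u`_i) ->
  forall i, (log1p_trunc N v)`_i = a ^+ i * (log1p_trunc N u)`_i.
Proof.
move=> vE.
have vX k : forall i, (v ^+ k)`_i = a ^+ i * (u ^+ k)`_i.
  elim: k => [|k ih] i.
    by rewrite !expr0 coef1; case: i => [|i]; rewrite ?mulr1 ?mulr0.
  rewrite !exprS !coefM mulr_sumr; apply: eq_bigr => -[j /= ji] _.
  rewrite vE ih -[in RHS](@subnKC j i)//.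
  by rewrite [in RHS]addKn exprD; ring.
move=> i; rewrite /log1p_trunc !coef_sum mulr_sumr; apply: eq_bigr => k _.
by rewrite !coefZ vX; ring.
Qed.

End log1p_trunc.

Section coef_cvg.
Variable R : realType.

Lemma cvg_sumr (I : Type) (r : seq I) (P : pred I) (f : I -> nat -> R) (l : I -> R) :
  (forall i, P i -> f i n @[n --> \oo] --> l i) ->
  (\sum_(i <- r | P i) f i n) @[n --> \oo] --> \sum_(i <- r | P i) l i.
Proof. by move=> fl; apply: cvg_big => //; exact: add_continuous. Qed.

Lemma cvg_coefX (p : nat -> {poly R}) (q : {poly R}) :
  (forall i, (p n)`_i @[n --> \oo] --> q`_i) ->
  forall k i, (p n ^+ k)`_i @[n --> \oo] --> (q ^+ k)`_i.
Proof.
move=> pq; elim=> [|k ih] i.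
  by under eq_fun do rewrite expr0; rewrite expr0; exact: cvg_cst.
rewrite exprS coefM; under eq_fun do rewrite exprS coefM.
by apply: cvg_sumr => j _; apply: cvgM.
Qed.

(** By truncation each coefficient is a polynomial in finitely many coefficients of the argument;
    this is how convergence of moments becomes convergence of cumulants. *)
Lemma cvg_log1p_trunc N (p : nat -> {poly R}) (q : {poly R}) :
  (forall i, (p n)`_i @[n --> \oo] --> q`_i) ->
  forall i, (log1p_trunc N (p n))`_i @[n --> \oo] --> (log1p_trunc N q)`_i.
Proof.
move=> pq i; rewrite /log1p_trunc coef_sum.
under eq_fun do rewrite coef_sum.
apply: cvg_sumr => k _; rewrite coefZ; under eq_fun do rewrite coefZ.
by apply: cvgMr; exact: cvg_coefX.
Qed.

End coef_cvg.

(** * Rigidity of power sums *)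

(** The inverse of 1 plus the sum of the inverses stands in for a minimum: it is at most 1 at once
    and makes sense for an empty [I]. *)
Lemma fin_pos_lower_bound (K : realFieldType) (I : finType) (f : I -> K) :
  (forall i, 0 < f i) -> exists m, [/\ 0 < m, m <= 1 & forall i, m <= f i].
Proof.
move=> f0; pose t := 1 + \sum_i (f i)^-1.
have s0 : 0 <= \sum_i (f i)^-1 by apply: sumr_ge0 => i _; rewrite invr_ge0 ltW.
have t0 : 0 < t by rewrite /t; lra.
exists t^-1; split; first by rewrite invr_gt0.
  by rewrite invf_le1// /t; lra.
move=> i; rewrite -[leRHS]invrK lef_pV2 ?posrE ?invr_gt0//.
rewrite /t (bigD1 i)//= ler_wpDl// lerDl.
by apply: sumr_ge0 => j _; rewrite invr_ge0 ltW.
Qed.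

Lemma ler_dist_exp (K : realFieldType) (x y : K) (n : nat) :
  `|x| <= 1 -> `|y| <= 1 -> `|x ^+ n - y ^+ n| <= n%:R * `|x - y|.
Proof.
move=> x1 y1; rewrite subrXX normrM mulrC ler_wpM2r//.
apply: (le_trans (ler_norm_sum _ _ _)).
rewrite -[n in n%:R]card_ord -sumr_const ler_sum// => i _.
by rewrite normrM !normrX mulr_ile1 ?exprn_ge0 ?exprn_ile1.
Qed.

Section rounding.
Variables (R : realType) (q : nat) (a : 'I_q -> R) (delta : R).
Hypotheses (delta_gt0 : 0 < delta) (delta_le1 : delta <= 1).
Hypothesis a_ge : forall r, 2 * delta <= `|a r|.
Hypothesis a_sep : forall r s, r != s -> 2 * delta <= `|a r - a s|.
Hypothesis a_le1 : forall r, `|a r| <= 1.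

Let near r x := `|x - a r| < delta.

(* At most one [r] is near [x]; the value is 0 when there is none. *)
Definition round_to x := \sum_r (near r x)%:R * a r.

Lemma near_inj r s x : near r x -> near s x -> r = s.
Proof.
rewrite /near => hr hs; apply/eqP; apply/negPn/negP => /a_sep.
have := ler_distD x (a r) (a s); rewrite (distrC (a r) x); lra.
Qed.

Lemma near_ge r x : near r x -> delta <= `|x|.
Proof.
rewrite /near => hr; have := a_ge r.
have := ler_distD x 0 (a r); rewrite !sub0r !normrN; lra.
Qed.

Lemma near_far r s x : near r x -> s != r -> delta <= `|x - a s|.
Proof. by move=> hr; rewrite leNgt; apply: contra_neqN => /near_inj; exact. Qed.

Lemma round_to_near r x : near r x -> round_to x = a r.
Proof.
move=> hr; rewrite /round_to (bigD1 r)//= hr mul1r big1 ?addr0// => s sr.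
by case: (boolP (near s x)) sr => [/near_inj -/(_ _ hr) ->|_ _]; rewrite ?eqxx ?mul0r.
Qed.

Lemma round_to_far x : (forall r, ~~ near r x) -> round_to x = 0.
Proof. by move=> h; rewrite /round_to big1// => r _; rewrite (negbTE (h r)) mul0r. Qed.

Lemma round_toP x :
  (exists2 r, near r x & round_to x = a r) \/
  ((forall r, ~~ near r x) /\ round_to x = 0).
Proof.
have [r hr|h] := pickP (fun r => near r x).
  by left; exists r => //; exact: round_to_near.
by right; split => [r|]; [rewrite h|apply: round_to_far => r; rewrite h].
Qed.

Let d := (delta ^+ 2) ^+ q.+1.

(** Since [delta <= 1], the exponent can be [q] whatever the size of [A]: all indices, or all but
    the nearest one. *)
Lemma prod_far (A : pred 'I_q) x : (forall r, A r -> delta <= `|x - a r|) ->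
  (delta ^+ 2) ^+ q <= \prod_(r | A r) (x - a r) ^+ 2.
Proof.
move=> h; have d1 : 0 <= delta ^+ 2 <= 1.
  by rewrite sqr_ge0 exprn_ile1// ltW.
apply: (@le_trans _ _ (\prod_(r | A r) delta ^+ 2)).
  rewrite prodr_const; apply: ler_wiXn2l; [lra|lra|].
  by rewrite -[leqRHS]card_ord max_card.
apply: ler_prod => r Ar; rewrite sqr_ge0 /= -[leRHS]real_normK ?num_real//.
by rewrite ler_pXn2r ?nnegrE ?h// ltW.
Qed.

(** The right side is the product of the squared distances from [x] to 0 and to the [a r]: the
    factor of the chosen point is kept, the others are bounded below through [delta]. A point far
    from every [a r] goes to 0 whether or not it is small, the kept factor then being [x ^+ 2]. *)
Lemma round_to_Delta x :
  d * (x - round_to x) ^+ 2 <= x ^+ 2 * \prod_r (x - a r) ^+ 2.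
Proof.
have d1 : 0 <= delta ^+ 2 <= 1 by rewrite sqr_ge0 exprn_ile1// ltW.
have dq : 0 <= (delta ^+ 2) ^+ q by rewrite exprn_ge0//; lra.
case: (round_toP x) => [[r hr ->]|[h ->]].
  rewrite (bigD1 r)//= [leRHS]mulrCA [leLHS]mulrC; apply: ler_wpM2l; first exact: sqr_ge0.
  rewrite /d exprS; apply: ler_pM; [lra|by []| |].
    rewrite -[leRHS]real_normK ?num_real//.
    by rewrite ler_pXn2r ?nnegrE ?(near_ge hr)// ltW.
  by apply: prod_far => s; exact: near_far.
rewrite subr0 mulrC; apply: ler_wpM2l; first exact: sqr_ge0.
apply: (@le_trans _ _ ((delta ^+ 2) ^+ q)).
  by rewrite /d exprS ler_piMl//; lra.
by apply: prod_far => s _; rewrite leNgt h.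
Qed.

(** The factor [|x|] is what makes the bound summable over infinitely many coefficients. Near some
    [a r] it can be inserted because [|x| >= delta]; when [x] is rounded to 0 it comes from
    [|x|^n <= x^2], hence [2 <= n]. *)
Lemma round_to_pow x n : `|x| <= 1 -> (2 <= n)%N ->
  `|x ^+ n - round_to x ^+ n| <= n%:R / delta * (`|x| * `|x - round_to x|).
Proof.
move=> x1 n2; case: (round_toP x) => [[r hr ->]|[h ->]].
  apply: (le_trans (ler_dist_exp _ x1 (a_le1 r))).
  rewrite -!mulrA ler_wpM2l// mulrCA mulrA ler_peMl//.
  by rewrite ler_pdivlMr// mul1r (near_ge hr).
rewrite expr0n -(prednK (ltnW n2)) subr0 prednK; last by lia.
rewrite subr0 normrX; apply: (@le_trans _ _ (`|x| * `|x|)).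
  by rewrite -expr2; apply: ler_wiXn2l.
rewrite ler_peMl ?mulr_ge0// ler_pdivlMr// mul1r (le_trans delta_le1)//.
by rewrite (ler_nat _ 1); lia.
Qed.

(** Terms rounded to 0 disappear since [0 < n]; grouping the others by target turns the power sum
    into a linear form in the counts. *)
Lemma sum_round_to_pow (x : nat -> R) N n : (0 < n)%N ->
  \sum_(j < N) round_to (x j) ^+ n =
  \sum_r #|[pred j : 'I_N | near r (x j)]|%:R * a r ^+ n.
Proof.
move=> n0; under [RHS]eq_bigr do rewrite -sum1_card natr_sum mulr_suml.
rewrite (exchange_big_dep predT)//=; apply: eq_bigr => j _.
case: (round_toP (x j)) => [[r hr ->]|[h ->]].
  rewrite (bigD1 r)//= mul1r big1 ?addr0// => s /andP[hs].
  by rewrite (near_inj hs hr) eqxx.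
by rewrite expr0n (gtn_eqF n0) big1// => r; rewrite inE (negbTE (h r)).
Qed.

End rounding.
(** Lagrange interpolation: weighting the equations by the coefficients of [L r], which vanishes at
    every other [a s], isolates [v r]. As the exponents start at 2, the surviving weight is [a r ^+
    2 * (L r).[a r]], nonzero because the [a r] are distinct and nonzero. *)
Lemma power_sums_bound (K : realFieldType) (q : nat) (a : 'I_q -> K) :
  injective a -> (forall r, a r != 0) ->
  exists2 M, 0 < M & forall (v : 'I_q -> K) (e : K),
    (forall n, (2 <= n <= q.+1)%N -> `|\sum_r v r * a r ^+ n| <= e) ->
    forall r, `|v r| <= M * e.
Proof.
move=> a_inj a0.
pose L r := \prod_(s | s != r) ('X - (a s)%:P).
have L_size r : size (L r) = q.
  have -> : L r = \prod_(s <- enum (predC1 r)) ('X - (a s)%:P) by rewrite big_enum.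
  rewrite size_prod_XsubC -cardE cardC1 card_ord.
  by rewrite prednK// (leq_ltn_trans _ (ltn_ord r)).
have L_eval r s : s != r -> (L r).[a s] = 0.
  by move=> sr; rewrite horner_prod (bigD1 s)//= hornerXsubC subrr mul0r.
have L_neq0 r : (L r).[a r] != 0.
  rewrite horner_prod; apply/prodf_neq0 => s sr.
  by rewrite hornerXsubC subr_eq0; apply: contra_neq sr => /a_inj.
have aL_gt0 r : 0 < `|a r ^+ 2 * (L r).[a r]|.
  by rewrite normr_gt0 mulf_neq0// expf_neq0.
have [m [m0 _ mle]] := fin_pos_lower_bound aL_gt0.
pose S := \sum_r \sum_(i < q) `|(L r)`_i|.
have S0 : 0 <= S by apply: sumr_ge0 => r _; apply: sumr_ge0.
exists ((S + 1) / m); first by rewrite divr_gt0//; lra.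
move=> v e ve r.
have e0 : 0 <= e by apply: le_trans (ve 2%N _); rewrite ?ltnS ?(leq_trans _ (ltn_ord r)).
rewrite mulrAC ler_pdivlMr//.
apply: (@le_trans _ _ (S * e)); last by rewrite ler_wpM2r//; lra.
apply: (@le_trans _ _ (`|v r| * `|a r ^+ 2 * (L r).[a r]|)).
  by rewrite ler_wpM2l.
have -> : `|v r| * `|a r ^+ 2 * (L r).[a r]| =
    `|\sum_(i < q) (L r)`_i * \sum_s v s * a s ^+ (i + 2)|.
  rewrite -normrM; congr (`|_|).
  transitivity (\sum_s v s * (a s ^+ 2 * (L r).[a s])).
    by rewrite (bigD1 r)//= big1 ?addr0// => s sr; rewrite L_eval// !mulr0.
  under [RHS]eq_bigr do rewrite mulr_sumr.
  rewrite exchange_big /=; apply: eq_bigr => s _.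
  rewrite horner_coef L_size !mulr_sumr; apply: eq_bigr => i _.
  by rewrite exprD; ring.
apply: (le_trans (ler_norm_sum _ _ _)).
rewrite /S [in leRHS](bigD1 r)//= mulrDl ler_wpDr//.
  by rewrite mulr_ge0//; apply: sumr_ge0 => s _; apply: sumr_ge0.
rewrite mulr_suml; apply: ler_sum => i _; rewrite normrM ler_wpM2l//.
by apply: ve; have := ltn_ord i; lia.
Qed.

(* For each limit coefficient [a r], exactly one [x k] lies near it: the counts
   of the [x k] near [a r] are integers which, by the power sums of orders
   2..q+1 and Lagrange interpolation, are close to 1. *)
Lemma power_sums_rigidity (R : realType) (q : nat) (a : 'I_q -> R) :
  (2 <= q)%N -> injective a -> (forall r, a r != 0) -> (forall r, `|a r| <= 1) ->
  exists U c : R, [/\ 0 < U, 0 < c &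
    forall (x P : nat -> R) (D : R),
    series (fun k => x k ^+ 2) @ \oo --> (1 : R) ->
    (forall n, (2 <= n <= q.+1)%N -> series (fun k => x k ^+ n) @ \oo --> P n) ->
    (forall N, series (fun k => x k ^+ 2 * \prod_r (x k - a r) ^+ 2) N <= D) ->
    D <= U ^+ 2 ->
    (forall n, (2 <= n <= q.+1)%N -> `|P n - \sum_r a r ^+ n| <= U) ->
    exists2 k : 'I_q -> nat, injective k &
      forall N, \sum_(j < N) (x j - \sum_r (k r == j)%:R * a r) ^+ 2 <= c * D].
Proof.
move=> q2 a_inj a0 a1.
have idx_in (i : 'I_q) : (2 <= i + 2 <= q.+1)%N by have := ltn_ord i; lia.
have idx_lt n : (2 <= n <= q.+1)%N -> (n - 2 < q)%N by lia.
have idx_sub n : (2 <= n <= q.+1)%N -> (n - 2 + 2 = n)%N by lia.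
have idx_gt0 n : (2 <= n <= q.+1)%N -> (0 < n)%N by lia.
have a_gt0 r : 0 < `|a r| / 2 by rewrite divr_gt0// normr_gt0.
have [d1 [d1_gt0 d1_le1 d1_le]] := fin_pos_lower_bound a_gt0.
(* The value 1 on the diagonal is a placeholder that keeps the function positive. *)
have gap_gt0 (rs : 'I_q * 'I_q) :
    0 < if rs.1 == rs.2 then 1 else `|a rs.1 - a rs.2| / 2.
  case: rs => r s /=; case: eqVneq => // rs.
  by rewrite divr_gt0// normr_gt0 subr_eq0; apply: contra_neq rs => /a_inj.
have [d2 [d2_gt0 d2_le1 d2_le]] := fin_pos_lower_bound gap_gt0.
pose delta := Num.min d1 d2.
have delta_gt0 : 0 < delta by rewrite lt_min d1_gt0.
have delta_le1 : delta <= 1 by rewrite ge_min d1_le1.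
have a_ge r : 2 * delta <= `|a r|.
  have : delta <= d1 by rewrite ge_min lexx.
  by have := d1_le r; lra.
have a_sep r s : r != s -> 2 * delta <= `|a r - a s|.
  move=> rs; have : delta <= d2 by rewrite ge_min lexx orbT.
  by have := d2_le (r, s); rewrite /= (negbTE rs); lra.
have [M M0 hM] := power_sums_bound a_inj a0.
pose c := ((delta ^+ 2) ^+ q.+1)^-1.
have c0 : 0 < c by rewrite invr_gt0 !exprn_gt0.
(* Rounding cost on a power sum in units of [U]: the first factor comes from [round_to_pow], [1 + c]
   from the two halves of AM-GM. *)
pose K1 := q.+1%:R / delta * (1 + c).
have K10 : 0 < K1 by rewrite mulr_gt0 ?divr_gt0 ?ltr0Sn//; lra.
(* Each count differs from 1 by at most [M * (K1 + 2) * U]: rounding accounts for [K1], the tail of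
   the series for 1, the deviation from the target for 1. With this [U] the product is less than
   1. *)
pose U := (M * (K1 + 2) + 1)^-1.
have MK : 0 < M * (K1 + 2) by rewrite mulr_gt0//; lra.
have U0 : 0 < U by rewrite invr_gt0; lra.
exists U, c; split => // x P D x1 xP xD DU PU.
have sum1 N : \sum_(j < N) x j ^+ 2 <= 1.
  have -> : \sum_(j < N) x j ^+ 2 = series (fun k => x k ^+ 2) N.
    by rewrite /series /= big_mkord.
  rewrite -(cvg_lim (@Rhausdorff R) x1); apply: nondecreasing_cvgn_le.
    by apply: nondecreasing_series => k _ _; exact: sqr_ge0.
  by apply/cvg_ex; exists 1.
have x_le1 j : `|x j| <= 1.
  rewrite -(@ler_pXn2r _ 2)// ?nnegrE// expr1n real_normK ?num_real//.
  apply: le_trans (sum1 j.+1); rewrite big_ord_recr /= lerDr.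
  by apply: sumr_ge0 => i _; exact: sqr_ge0.
pose b := round_to a delta.
have hDelta N : \sum_(j < N) (x j - b (x j)) ^+ 2 <= c * D.
  rewrite mulrC ler_pdivlMr ?exprn_gt0 ?exprn_gt0// mulrC.
  apply: le_trans (xD N); rewrite /series /= big_mkord mulr_sumr.
  by apply: ler_sum => j _; exact: round_to_Delta.
have pow_dist N n : (2 <= n <= q.+1)%N ->
    `|\sum_(j < N) x j ^+ n - \sum_(j < N) b (x j) ^+ n| <= K1 * U.
  move=> /andP[n2 nq]; rewrite -sumrB; apply: (le_trans (ler_norm_sum _ _ _)).
  (* AM-GM with weights [U] and [U^-1]: the first part sums to at most [U], the second to at most
     [c * D / U], hence [c * U] by [D <= U ^+ 2]. *)
  apply: (@le_trans _ _ (\sum_(j < N) q.+1%:R / delta *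
      (U * x j ^+ 2 + U^-1 * (x j - b (x j)) ^+ 2))).
    apply: ler_sum => j _; apply: le_trans.
      exact: (round_to_pow delta_gt0 delta_le1 a_ge a_sep a1 (x_le1 j) n2).
    apply: ler_pM => //; [by rewrite divr_ge0// ltW| |].
      by rewrite ler_wpM2r ?ler_nat// invr_ge0 ltW.
    rewrite -[x j ^+ 2]real_normK ?num_real// -[(x j - _) ^+ 2]real_normK ?num_real//.
    set u := `|x j|; set w := `|x j - _|.
    have -> : U * u ^+ 2 + U^-1 * w ^+ 2 = U^-1 * ((U * u) ^+ 2 + w ^+ 2).
      by field; rewrite gt_eqF.
    rewrite [leRHS]mulrC ler_pdivlMr//.
    have := sqr_ge0 (U * u - w); have := sqr_ge0 (U * u + w).
    by rewrite sqrrB sqrrD; lra.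
  rewrite -mulr_sumr big_split /= -!mulr_sumr /K1 -[leRHS]mulrA.
  apply: ler_wpM2l; first by rewrite divr_ge0// ltW.
  rewrite mulrDl mul1r; apply: lerD; first by rewrite ler_piMr ?sum1 ?ltW.
  rewrite mulrC ler_pdivrMr// -mulrA -expr2.
  by apply: (le_trans (hDelta N)); rewrite ler_wpM2l// ltW.
pose cnt r N := #|[pred j : 'I_N | `|x j - a r| < delta]|.
have cntE : \forall N \near \oo, forall r, cnt r N = 1%N.
  have near_P : \forall N \near \oo, forall i : 'I_q,
      `|P (i + 2)%N - series (fun k => x k ^+ (i + 2)) N| < U.
    apply: filter_forall => i.
    by move/cvgrPdist_lt : (xP _ (idx_in i)) => /(_ _ U0).
  near=> N; move=> r.
  have near_Q : forall n, (2 <= n <= q.+1)%N ->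
      `|P n - \sum_(j < N) x j ^+ n| <= U.
    move=> n nq; have iq := idx_lt _ nq.
    have : forall i : 'I_q,
      `|P (i + 2)%N - series (fun k => x k ^+ (i + 2)) N| < U by near: N.
    move=> /(_ (Ordinal iq)) /ltW /=; rewrite idx_sub//.
    by rewrite /series /= big_mkord.
  have := hM (fun r => (cnt r N)%:R - 1) ((K1 + 2) * U) _ r.
  have vE n : (2 <= n <= q.+1)%N ->
      `|\sum_r ((cnt r N)%:R - 1) * a r ^+ n| <= (K1 + 2) * U.
    move=> nq; under eq_bigr do rewrite mulrBl mul1r.
    rewrite sumrB /cnt -(sum_round_to_pow a_sep _ _ (idx_gt0 _ nq)) -/b.
    have := pow_dist N _ nq; have := near_Q _ nq; have := PU _ nq.
    rewrite !ler_norml; lra.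
  move=> /(_ vE); rewrite mulrA => h.
  have {h} : `|(cnt r N)%:R - 1 : R| < 1.
    apply: (le_lt_trans h); rewrite /U ltr_pdivrMr; lra.
  rewrite ltr_norml => /andP[h1 h2].
  have cnt_gt0 : (0 < cnt r N)%N by rewrite -(ltr_nat R); lra.
  have cnt_lt2 : (cnt r N < 2)%N by rewrite -(ltr_nat R); lra.
  by move: cnt_gt0 cnt_lt2; case: (cnt r N) => [|[|]].
have [N0 _ hN0] := cntE.
have uniq_near r : exists k : nat, forall j : nat, (`|x j - a r| < delta) = (k == j).
  have /eqP/card1P[k hk] := hN0 N0 (leqnn _) r.
  exists k => j; apply/idP/eqP => [hj|<-]; last first.
    by have := hk k; rewrite !inE eqxx.
  (* The count is still 1 at a cutoff containing both [k] and [j], so [j] cannot be a second index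
     near [a r]. *)
  pose N := maxn N0 j.+1.
  have /eqP/card1P[l hl] := hN0 N (leq_maxl _ _) r.
  have kN : (k < N)%N by rewrite (leq_trans (ltn_ord k))// leq_maxl.
  have jN : (j < N)%N by rewrite leq_maxr.
  have := hl (Ordinal kN); have := hk k; rewrite !inE /= eqxx => -> /esym/eqP kl.
  have := hl (Ordinal jN); rewrite !inE /= hj -kl => /esym/eqP.
  by move=> [].
have [k hk] := choice uniq_near.
exists k => [r s krs|N].
  apply: (@near_inj _ _ a delta a_sep r s (x (k r))); rewrite hk//.
  by rewrite krs.
apply: le_trans (hDelta N); rewrite le_eqVlt; apply/orP; left; apply/eqP.
by apply: eq_bigr => j _; rewrite /b /round_to; under eq_bigr do rewrite -hk.
Unshelve. all: by end_near. Qed.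

(** * Independent pairs *)

(** Rectangles are stable under intersection, generate the product sigma-algebra and include the
    whole space, which serves as a constant exhaustion. *)
Lemma measure_eq_rect (R : realType) (d1 d2 : measure_display)
    (T1 : measurableType d1) (T2 : measurableType d2)
    (m1 m2 : {measure set (T1 * T2) -> \bar R}) :
  (m1 setT < +oo)%E ->
  (forall A B, measurable A -> measurable B -> m1 (A `*` B) = m2 (A `*` B)) ->
  forall C, measurable C -> m1 C = m2 C.
Proof.
move=> m1oo m12 C mC.
pose G := [set A `*` B | A in @measurable _ T1 & B in @measurable _ T2].
apply: (measure_unique G (fun _ => setT)) => //.
- exact: measurable_prod_measurableType.
- move=> _ _ [A mA [B mB <-]] [A' mA' [B' mB' <-]]; rewrite -setXI.
  by exists (A `&` A'); [exact: measurableI|exists (B `&` B'); [exact: measurableI|]].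
- by move=> _; exists setT => //; exists setT => //; rewrite setXTT.
- by rewrite bigcup_const.
- by move=> _ [A mA [B mB <-]]; exact: m12.
Qed.

Section pair_of_random_variables.
Context {R : realType} {d : measure_display} {T : measurableType d}.
Context {P : probability T R}.
Variables X Y : {RV P >-> R}.

Definition rv_pair (w : T) : R * R := (X w, Y w).

Lemma measurable_rv_pair : measurable_fun [set: T] rv_pair.
Proof. exact: measurable_fun_pair. Qed.

HB.instance Definition _ :=
  isMeasurableFun.Build _ _ _ _ rv_pair measurable_rv_pair.

Definition independent_pair := forall A B : set R, measurable A -> measurable B ->
  P (X @^-1` A `&` Y @^-1` B) = (P (X @^-1` A) * P (Y @^-1` B))%E.

(** Both sides are finite measures of [C], one restricted to [E], the other scaled by [P E], so
    rectangles decide. A function of the pair thus inherits independence from [E], as needed when a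
    term joins a linear combination. *)
Lemma independent_pair_event (E : set T) : measurable E ->
  (forall A B : set R, measurable A -> measurable B ->
    P (X @^-1` A `&` Y @^-1` B `&` E) = (P (X @^-1` A) * P (Y @^-1` B) * P E)%E) ->
  independent_pair ->
  forall C : set (R * R), measurable C ->
    P (rv_pair @^-1` C `&` E) = (P (rv_pair @^-1` C) * P E)%E.
Proof.
move=> mE hE hXY C mC.
pose m1 : {measure set (R * R) -> \bar R} := pushforward (mrestr P mE) rv_pair.
pose r : {nonneg R} := NngNum (fine_ge0 (measure_ge0 P E)).
pose m2 : {measure set (R * R) -> \bar R} := mscale r (pushforward P rv_pair).
have PE : ((fine (P E))%:E = P E)%E by rewrite fineK// fin_num_measure.
have := @measure_eq_rect R _ _ _ _
  (m1 measurable_rv_pair) (m2 measurable_rv_pair) _ _ C mC.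
rewrite /= /mscale /= /pushforward /mrestr /= PE muleC; apply.
  by rewrite preimage_setT setTI (le_lt_trans (probability_le1 _ mE)) ?ltry.
move=> A B mA mB; rewrite [_ @^-1` _](_ : _ = X @^-1` A `&` Y @^-1` B)//.
by rewrite hE// hXY// muleC.
Qed.

Lemma independent_pair_distribution : independent_pair ->
  forall C : set (R * R), measurable C ->
    P (rv_pair @^-1` C) = (distribution P X \x distribution P Y)%E C.
Proof.
move=> hXY C mC; have := @measure_eq_rect R _ _ _ _ (distribution P rv_pair)
  (distribution P X \x distribution P Y)%E _ _ C mC; apply.
  by rewrite (le_lt_trans (probability_le1 _ _)) ?ltry.
move=> A B mA mB; rewrite [RHS](product_measure1E (distribution P X) (distribution P Y))//.
exact: hXY.
Qed.

Hypothesis XY : independent_pair.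

(** Under the product law, Tonelli gives integrability and Fubini the factorization; both are
    transported back through the pair. Integrability is concluded too because expansions into such
    products are integrated later. *)
Lemma independent_pair_integral (f g : R -> R) :
  measurable_fun setT f -> measurable_fun setT g ->
  P.-integrable setT (EFin \o (f \o X)) -> P.-integrable setT (EFin \o (g \o Y)) ->
  P.-integrable setT (fun w => (f (X w) * g (Y w))%:E) /\
  (\int[P]_w (f (X w) * g (Y w)) = \int[P]_w f (X w) * \int[P]_w g (Y w))%R.
Proof.
move=> mf mg fX gY.
pose h (z : R * R) := (f z.1 * g z.2)%:E.
have mh : measurable_fun setT h.
  apply/measurable_EFinP; apply: measurable_funM.
    exact: measurableT_comp mf measurable_fst.
  exact: measurableT_comp mg measurable_snd.
pose Q := (distribution P X \x distribution P Y)%E.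
have QE D (k : R * R -> \bar R) :
    (\int[distribution P rv_pair]_(z in D) k z = \int[Q]_(z in D) k z)%E.
  apply: eq_measure_integral => C mC _; exact: independent_pair_distribution.
have fX' : (distribution P X).-integrable setT (EFin \o f).
  by apply: integrable_pushforward => //; exact/measurable_EFinP.
have gY' : (distribution P Y).-integrable setT (EFin \o g).
  by apply: integrable_pushforward => //; exact/measurable_EFinP.
have intQ : Q.-integrable setT h.
  apply/integrable12ltyP => //.
  under eq_integral => x _.
    under eq_integral => y _ do rewrite /h /= normrM EFinM.
    rewrite ge0_integralZl//=; last first.
      by apply/measurable_EFinP; exact: measurableT_comp.
    over.
  rewrite /= ge0_integralZr//=; last 2 first.
    by apply/measurable_EFinP; exact: measurableT_comp.
    exact: integral_ge0.
  apply: lte_mul_pinfty; first exact: integral_ge0.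
    by apply: integrable_fin_num => //; exact: integrable_norm.
  by apply: integrable_lty => //; exact: integrable_norm.
have inth : P.-integrable setT (h \o rv_pair).
  apply/integrableP; split; first exact: measurableT_comp.
  have -> : (\int[P]_w `|(h \o rv_pair) w| = \int[Q]_z `|h z|)%E.
    rewrite -QE ge0_integral_distribution//.
    exact: measurableT_comp.
  by have /integrableP[] := intQ.
split; first exact: inth.
rewrite /Rintegral.
have -> : (\int[P]_w (f (X w) * g (Y w))%:E = \int[Q]_z h z)%E.
  by rewrite -QE integral_distribution.
rewrite -integral12_prod_meas1// /fubini_F /h /=.
under eq_integral => x _.
  under eq_integral => y _ do rewrite EFinM.
  rewrite integralZl//=.
  over.
rewrite /=.
have gfin := integrable_fin_num measurableT gY'.
rewrite -(fineK gfin) integralZr//= fineM// ?(integrable_fin_num measurableT fX')//.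
by rewrite !integral_distribution//; exact/measurable_EFinP.
Qed.

End pair_of_random_variables.

(** * Laws and moments of linear combinations *)

Definition all_moments {R : realType} {d} {T : measurableType d}
    (P : probability T R) (X : T -> R) :=
  forall p : nat, P.-integrable setT (fun w => (X w ^+ p)%:E).

Section lincomb.
Context {R : realType} {d : measure_display} {T : measurableType d}.
Context {P : probability T R}.
Variable W : nat -> {RV P >-> R}.

(** Lists of index-coefficient pairs cover at once the partial sums of [F_n], the target and the
    rounded sum, whose indices are scattered, and they allow induction on the list. *)
Definition lincomb (s : seq (nat * R)) : {RV P >-> R} :=
  \sum_(x <- s) x.2 *: W x.1.

Lemma lincombE s w : lincomb s w = \sum_(x <- s) x.2 * W x.1 w.
Proof. by rewrite /lincomb mfun_sum. Qed.

Lemma lincomb_cons x s w : lincomb (x :: s) w = x.2 * W x.1 w + lincomb s w.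
Proof. by rewrite !lincombE big_cons. Qed.

Lemma measurable_lin_event (a : R) (A : set R) : measurable A ->
  measurable [set p : R * R | A (a * p.2 + p.1)].
Proof.
move=> mA; rewrite -[X in measurable X]setTI.
apply: (_ : measurable_fun [set: R * R] (fun p : R * R => a * p.2 + p.1)) => //.
apply: measurable_funD => //; apply: measurable_funM => //.
Qed.

Hypothesis W_indep : mutually_independent W.

(** The extra events indexed by [J] are there for the induction: to add the term of index [k], the
    induction hypothesis is used with [k] among them. *)
Lemma lincomb_indep s (J : seq nat) (B : nat -> set R) (A : set R) :
  uniq (unzip1 s ++ J) -> measurable A -> (forall j, j \in J -> measurable (B j)) ->
  P (lincomb s @^-1` A `&` \bigcap_(j in [set` J]) W j @^-1` B j) =
  (P (lincomb s @^-1` A) * \prod_(j <- J) P (W j @^-1` B j))%E.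
Proof.
elim: s J B A => [|[k a] s ih] J B A /= uJ mA mB.
  rewrite -W_indep//.
  have [A0|A0] := pselect (A 0).
    have -> : lincomb [::] @^-1` A = setT.
      by apply/seteqP; split => // w _ /=; rewrite lincombE big_nil.
    by rewrite setTI probability_setT mul1e.
  have -> : lincomb [::] @^-1` A = set0.
    by apply/seteqP; split => // w /=; rewrite lincombE big_nil.
  by rewrite set0I measure0 mul0e.
move: uJ; rewrite mem_cat negb_or => /andP[/andP[ks kJ] uJ].
pose E := \bigcap_(j in [set` J]) W j @^-1` B j.
have mE : measurable E.
  by apply: fin_bigcap_measurable => // j jJ; apply: measurable_funPTI => //; exact: mB.
have kindep (J' : seq nat) A1 A2 (B' : nat -> set R) :
    uniq (unzip1 s ++ J') -> k \notin J' ->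
    (forall j, j \in J' -> measurable (B' j)) -> measurable A1 -> measurable A2 ->
    P (lincomb s @^-1` A1 `&` W k @^-1` A2 `&` \bigcap_(j in [set` J']) W j @^-1` B' j) =
    (P (lincomb s @^-1` A1) * P (W k @^-1` A2) *
      P (\bigcap_(j in [set` J']) W j @^-1` B' j))%E.
  move=> uJ' kJ' mB' mA1 mA2; rewrite -setIA.
  pose B2 j := if j == k then A2 else B' j.
  have B2E : forall j, j \in J' -> B2 j = B' j.
    by move=> j jJ; rewrite /B2; case: eqVneq => // jk; rewrite -jk jJ in kJ'.
  have -> : W k @^-1` A2 `&` \bigcap_(j in [set` J']) W j @^-1` B' j =
      \bigcap_(j in [set` k :: J']) W j @^-1` B2 j.
    have -> : [set` k :: J'] = k |` [set` J'].
      apply/seteqP; split => j /=; rewrite inE.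
        by move=> /predU1P.
      by move=> /predU1P.
    rewrite bigcap_setU1 {1}/B2 eqxx; congr (_ `&` _).
    by apply: eq_bigcapr => j jJ; rewrite B2E.
  rewrite ih//; last 2 first.
    rewrite -[k :: J']cat1s (perm_uniq (_ : perm_eq _ (k :: unzip1 s ++ J'))).
      by rewrite /= mem_cat negb_or ks kJ'.
    by rewrite perm_catCA.
    move=> j; rewrite inE /B2; case: eqVneq => // _ /=; exact: mB'.
  rewrite big_cons {1}/B2 eqxx -muleA; congr (_ * (_ * _))%E.
  rewrite W_indep//; last by move: uJ'; rewrite cat_uniq => /and3P[].
  by apply: eq_big_seq => j jJ; rewrite B2E.
have XY : independent_pair (lincomb s) (W k).
  move=> A1 A2 mA1 mA2.
  have := kindep [::] A1 A2 (fun=> setT); rewrite set_nil bigcap_set0 !setIT.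
  rewrite probability_setT mule1; apply => //.
  by rewrite cats0; move: uJ; rewrite cat_uniq => /andP[].
have -> : lincomb ((k, a) :: s) @^-1` A =
    rv_pair (lincomb s) (W k) @^-1` [set p : R * R | A (a * p.2 + p.1)].
  by apply/seteqP; split => w /=; rewrite lincomb_cons.
rewrite -W_indep//; last by move: uJ; rewrite cat_uniq => /and3P[].
apply: independent_pair_event => //; last exact: measurable_lin_event.
by move=> A1 A2 mA1 mA2; exact: kindep.
Qed.

Lemma lincomb_independent_pair k s : uniq (k :: unzip1 s) ->
  independent_pair (lincomb s) (W k).
Proof.
move=> /= /andP[ks us] A1 A2 mA1 mA2.
have := @lincomb_indep s [:: k] (fun=> A2) A1.
rewrite big_seq1 set_cons1 bigcap_set1; apply => //.
by rewrite cats1 rcons_uniq ks.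
Qed.

End lincomb.

Section laws.
Context {R : realType} {d : measure_display} {T : measurableType d}.
Context {P : probability T R}.

Lemma same_law_integral (d' : measure_display) (T' : measurableType d')
    (P' : probability T' R) (X : {RV P >-> R}) (Y : {RV P' >-> R}) (f : R -> \bar R) :
  same_law X Y -> measurable_fun setT f -> P.-integrable setT (f \o X) ->
  P'.-integrable setT (f \o Y) /\
  (\int[P]_w f (X w) = \int[P']_w f (Y w))%E.
Proof.
move=> XY mf fX.
have fY : P'.-integrable setT (f \o Y).
  apply/integrableP; split; first exact: measurableT_comp.
  have -> : (\int[P']_w `|(f \o Y) w| = \int[distribution P X]_y `|f y|)%E.
    rewrite (eq_measure_integral (distribution P' Y)); last by move=> A mA _; exact: XY.
    by rewrite ge0_integral_distribution//; exact: measurableT_comp.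
  rewrite ge0_integral_distribution//; last exact: measurableT_comp.
  by have /integrableP[] := fX.
split=> //.
rewrite -[LHS](integral_distribution mf fX) -[RHS](integral_distribution mf fY).
by apply: eq_measure_integral => A mA _; exact: XY.
Qed.

Lemma same_law_lin (X Y X' Y' : {RV P >-> R}) (a : R) :
  independent_pair X Y -> independent_pair X' Y' ->
  same_law X X' -> same_law Y Y' ->
  same_law (a *: Y + X : {RV P >-> R}) (a *: Y' + X' : {RV P >-> R}).
Proof.
move=> XY XY' XX' YY' A mA.
have mC := measurable_lin_event a mA.
transitivity (P (rv_pair X Y @^-1` [set p : R * R | A (a * p.2 + p.1)])) => //.
transitivity (P (rv_pair X' Y' @^-1` [set p : R * R | A (a * p.2 + p.1)])) => //.
rewrite !independent_pair_distribution//.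
apply: (@measure_eq_rect R _ _ _ _ (distribution P X \x distribution P Y)%E
  (distribution P X' \x distribution P Y')%E) => //.
  by rewrite (le_lt_trans (probability_le1 _ _)) ?ltry.
move=> B C mB mC'.
rewrite [LHS](product_measure1E (distribution P X) (distribution P Y))//.
rewrite [RHS](product_measure1E (distribution P X') (distribution P Y'))//.
by congr (_ * _)%E; [exact: XX'|exact: YY'].
Qed.

(** Only the coefficients matter, not the indices that carry them: this is what gives the rounded
    sum the law of the target. *)
Lemma same_law_lincomb (W : nat -> {RV P >-> R}) s s' :
  mutually_independent W -> (forall j k, same_law (W j) (W k)) ->
  uniq (unzip1 s) -> uniq (unzip1 s') -> unzip2 s = unzip2 s' ->
  same_law (lincomb W s) (lincomb W s').
Proof.
move=> W_indep W_law; elim: s s' => [|[k a] s ih] [|[k' a'] s'] //= us us' [<- ss'].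
rewrite /lincomb !big_cons /=.
apply: same_law_lin; [exact: lincomb_independent_pair..| |exact: W_law].
by apply: ih => //; [move: us => /andP[]|move: us' => /andP[]].
Qed.

End laws.

Lemma momentE (R : realType) (d : measure_display) (T : measurableType d)
    (P : probability T R) (X : T -> R) n : moment P X n = \int[P]_w (X w ^+ n).
Proof. by rewrite /moment unlock. Qed.

Section moments.
Context {R : realType} {d : measure_display} {T : measurableType d}.
Context {P : probability T R}.
Implicit Types X Y : {RV P >-> R}.

Lemma moment0 (X : T -> R) : moment P X 0 = 1.
Proof.
rewrite momentE; under eq_Rintegral do rewrite expr0.
rewrite Rintegral_cst// (_ : fine _ = 1) ?mulr1// -[1]/(fine 1%:E).
by congr fine; exact: probability_setT.
Qed.

Lemma same_law_moment (d' : measure_display) (T' : measurableType d')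
    (P' : probability T' R) X (Y : {RV P' >-> R}) n : same_law X Y -> all_moments P X ->
  moment P X n = moment P' Y n.
Proof.
move=> XY mX; rewrite !momentE /Rintegral; congr fine.
have mf : measurable_fun [set: R] (fun x : R => (x ^+ n)%:E).
  by apply/measurable_EFinP; exact: exprn_measurable.
by have [_ ->] := same_law_integral XY mf (mX n).
Qed.

Lemma same_law_all_moments X Y : same_law X Y -> all_moments P X -> all_moments P Y.
Proof.
move=> XY mX n; have mf : measurable_fun [set: R] (fun x : R => (x ^+ n)%:E).
  by apply/measurable_EFinP; exact: exprn_measurable.
by have [] := same_law_integral XY mf (mX n).
Qed.

Lemma moment_lin X Y (a : R) :
  independent_pair X Y -> all_moments P X -> all_moments P Y ->
  all_moments P (a *: Y + X) /\ forall n, moment P (a *: Y + X) n =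
    \sum_(i < n.+1) 'C(n, i)%:R * (a ^+ i * moment P Y i) * moment P X (n - i).
Proof.
move=> XY mX mY.
have prod i j := independent_pair_integral XY (@exprn_measurable _ _ i)
  (@exprn_measurable _ _ j) (mX i) (mY j).
have expand n w : ((a *: Y + X : {RV P >-> R}) w ^+ n) =
    \sum_(i < n.+1) ('C(n, i)%:R * a ^+ i) * (X w ^+ (n - i) * Y w ^+ i).
  rewrite (_ : (a *: Y + X : {RV P >-> R}) w = X w + a * Y w); last exact: addrC.
  rewrite exprDn; apply: eq_bigr => i _.
  by rewrite exprMn -mulr_natl; ring.
have int_term n (i : 'I_n.+1) : P.-integrable setT
    (fun w => ('C(n, i)%:R * a ^+ i)%:E * (X w ^+ (n - i) * Y w ^+ i)%:E)%E.
  by apply: integrableZl => //; have [] := prod (n - i)%N i.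
have int_sum n : (fun w => ((a *: Y + X : {RV P >-> R}) w ^+ n)%:E) =
    (fun w => \sum_(i < n.+1) ('C(n, i)%:R * a ^+ i)%:E *
      (X w ^+ (n - i) * Y w ^+ i)%:E)%E.
  by apply/funext => w; rewrite expand -sumEFin.
split=> n; first by rewrite int_sum; exact: integrable_sum.
rewrite momentE /Rintegral int_sum integral_sum//.
rewrite -sum_fine; last by move=> i _; exact: integrable_fin_num.
apply: eq_bigr => i _; have [prodi prodE] := prod (n - i)%N i.
rewrite integralZl// fineM//; last exact: integrable_fin_num.
by rewrite !momentE [X in _ * X = _]prodE /=; ring.
Qed.

End moments.

(** * Cumulants and moment bounds of linear combinations *)

Section cumulants_of_sums.
Context {R : realType} {d : measure_display} {T : measurableType d}.
Variable P : probability T R.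

Lemma cumulantE (X : T -> R) r :
  cumulant P X r = r`!%:R * (log1p_trunc r (mgf_tail P X r))`_r.
Proof. by []. Qed.

Lemma eq_moment_cumulant (d' : measure_display) (T' : measurableType d')
    (P' : probability T' R) (X : T -> R) (Y : T' -> R) r :
  (forall n, moment P X n = moment P' Y n) -> cumulant P X r = cumulant P' Y r.
Proof.
move=> XY; rewrite /cumulant (_ : mgf_tail P X r = mgf_tail P' Y r)//.
by apply/polyP => i; rewrite !coef_poly XY.
Qed.

Lemma coef0_mgf_tail (X : T -> R) r : (mgf_tail P X r)`_0 = 0.
Proof. by rewrite coef_poly. Qed.

Lemma coef_1mgf_tail (X : T -> R) r i : (i <= r)%N ->
  (1 + mgf_tail P X r)`_i = moment P X i / i`!%:R.
Proof.
move=> ir; rewrite coefD coef1 coef_poly ltnS ir.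
by case: i {ir} => [|i]; rewrite ?add0r// moment0 addr0 fact0 divr1.
Qed.

(** After division by [n!], the binomial convolution of moments is a Cauchy product of exponential
    generating series, which the logarithm turns into a sum. *)
Lemma cumulant_lin (X Y Z : T -> R) (a : R) r : (0 < r)%N ->
  (forall n, moment P Z n = \sum_(i < n.+1)
     'C(n, i)%:R * (a ^+ i * moment P Y i) * moment P X (n - i)) ->
  cumulant P Z r = cumulant P X r + a ^+ r * cumulant P Y r.
Proof.
move=> r0 Zm; rewrite !cumulantE.
pose v := \poly_(j < r.+1) (a ^+ j * (mgf_tail P Y r)`_j).
have vE i : v`_i = a ^+ i * (mgf_tail P Y r)`_i.
  rewrite coef_poly; case: ltnP => // ri.
  by rewrite [in RHS]coef_poly ltnNge ri /= mulr0.
rewrite mulrCA -mulrDr -(log1p_trunc_scale r vE); congr (_ * _).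
rewrite addrC; apply: log1p_truncM => //.
- by rewrite vE coef0_mgf_tail mulr0.
- exact: coef0_mgf_tail.
move=> i ir; rewrite coefB coefM coef_1mgf_tail// Zm.
apply/eqP; rewrite subr_eq0; apply/eqP; rewrite mulr_suml.
apply: eq_bigr => -[j /= ji] _.
have -> : (1 + v)`_j = a ^+ j * (moment P Y j / j`!%:R).
  rewrite -(@coef_1mgf_tail _ r); last by lia.
  rewrite !coefD !coef1 vE; case: j {ji} => [|j]; rewrite ?expr0 ?mul1r//.
  by rewrite !add0r.
rewrite coef_1mgf_tail; last by lia.
have -> : i`!%:R = 'C(i, j)%:R * (j`!%:R * (i - j)`!%:R) :> R.
  by rewrite -!natrM bin_fact.
by field; rewrite !pnatr_eq0 -!lt0n !fact_gt0 bin_gt0 -ltnS ji.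
Qed.

End cumulants_of_sums.

Section moments_of_lincomb.
Context {R : realType} {d : measure_display} {T : measurableType d}.
Context {P : probability T R}.
Variable W : nat -> {RV P >-> R}.
Hypothesis W_indep : mutually_independent W.
Hypothesis W_law : forall j k, same_law (W j) (W k).
Hypothesis W_moments : all_moments P (W 0%N).

Let W_all_moments k : all_moments P (W k).
Proof. exact: same_law_all_moments (W_law 0 k) W_moments. Qed.

Let W_momentE k n : moment P (W k) n = moment P (W 0%N) n.
Proof. exact: same_law_moment. Qed.

Lemma moment_lincomb_nil n : moment P (lincomb W [::]) n = (n == 0%N)%:R.
Proof.
case: n => [|n]; first by rewrite moment0.
rewrite momentE; under eq_Rintegral do rewrite lincombE big_nil expr0n /=.
by rewrite Rintegral_cst// mul0r.
Qed.

Lemma lincomb_all_moments s : uniq (unzip1 s) -> all_moments P (lincomb W s).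
Proof.
elim: s => [_ n|[k a] s ih /= /andP[ks us]].
  have -> : (fun w => (lincomb W [::] w ^+ n)%:E) = (fun=> (0 ^+ n)%:E).
    by apply/funext => w; rewrite lincombE big_nil.
  exact: finite_measure_integrable_cst.
rewrite /lincomb big_cons /=.
apply: (moment_lin a _ (ih us) (W_all_moments k)).1.
by apply: lincomb_independent_pair => //=; rewrite ks.
Qed.

Lemma moment_lincomb_cons k a s n : uniq (k :: unzip1 s) ->
  moment P (lincomb W ((k, a) :: s)) n = \sum_(i < n.+1)
    'C(n, i)%:R * (a ^+ i * moment P (W 0%N) i) * moment P (lincomb W s) (n - i).
Proof.
move=> us; have /= /andP[_ us'] := us.
have [_] := moment_lin a (lincomb_independent_pair W_indep us)
  (lincomb_all_moments us') (W_all_moments k).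
move=> /(_ n); rewrite /lincomb big_cons /= => ->.
by apply: eq_bigr => i _; rewrite -(W_momentE k).
Qed.

Lemma cumulant_lincomb s r : uniq (unzip1 s) -> (0 < r)%N ->
  cumulant P (lincomb W s) r = cumulant P (W 0%N) r * \sum_(x <- s) x.2 ^+ r.
Proof.
move=> + r0; elim: s => [_|[k a] s ih /= us].
  rewrite big_nil mulr0 cumulantE (_ : mgf_tail _ _ _ = 0).
    rewrite /log1p_trunc big_add1 /= big1 ?coef0 ?mulr0// => k _.
    by rewrite expr0n scaler0.
  apply/polyP => i; rewrite coef_poly coef0 moment_lincomb_nil.
  by case: ifP => // _; case: i => [|i] /=; rewrite ?mul0r.
rewrite big_cons mulrDr -ih; last by move: us => /andP[].
rewrite (cumulant_lin (X := lincomb W s) (Y := W 0%N) (a := a))//=.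
  by rewrite addrC mulrC.
by move=> n; exact: moment_lincomb_cons.
Qed.

Hypothesis W_mean : moment P (W 0%N) 1 = 0.

Lemma moment2_lincomb s : moment P (W 0%N) 2 = 1 -> uniq (unzip1 s) ->
  moment P (lincomb W s) 2 = \sum_(x <- s) x.2 ^+ 2.
Proof.
move=> W2; elim: s => [_|[k a] s ih us]; first by rewrite moment_lincomb_nil big_nil.
rewrite moment_lincomb_cons// !big_ord_recl big_ord0 /= /bump /= W_mean W2.
move: us => /= /andP[_ us]; rewrite big_cons ih// !moment0 /= bin0 bin1 binn.
by ring.
Qed.

(* The variables being centred, adding the term [a *: W k] changes the moment of
   order [n] by O(a^2), uniformly by induction on [n]. *)
Lemma moment_lincomb_bounded n : exists B, forall s, uniq (unzip1 s) ->
  \sum_(x <- s) x.2 ^+ 2 <= 1 -> `|moment P (lincomb W s) n| <= B.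
Proof.
(* All orders up to [n] are bounded together, since expanding a moment brings in every lower one. *)
suff [B hB] : exists B, forall m, (m < n.+1)%N -> forall s, uniq (unzip1 s) ->
    \sum_(x <- s) x.2 ^+ 2 <= 1 -> `|moment P (lincomb W s) m| <= B.
  by exists B => s; exact: hB.
elim: n.+1 => {n}[|n [B hB]]; first by exists 0.
have B0 : 0 <= `|B| by [].
pose K := \sum_(i < n) 'C(n, i.+1)%:R * `|moment P (W 0%N) i.+1| * `|B|.
have K0 : 0 <= K by apply: sumr_ge0 => i _; rewrite !mulr_ge0.
exists (`|B| + (1 + K)) => m; rewrite ltnS leq_eqVlt => /predU1P[->|mn] s us s1; last first.
  by apply: (le_trans (hB _ mn _ us s1)); have := ler_norm B; lra.
(* Each new coefficient [a] costs at most [K * a ^+ 2]; the 1 covers the empty list. *)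
suff : `|moment P (lincomb W s) n| <= 1 + K * \sum_(x <- s) x.2 ^+ 2.
  move=> /le_trans; apply; have : K * \sum_(x <- s) x.2 ^+ 2 <= K by rewrite ler_piMr.
  by lra.
elim: s us s1 => [|[k a] s ih] us s1.
  by rewrite big_nil mulr0 addr0 moment_lincomb_nil ger0_norm// lern1 leq_b1.
rewrite moment_lincomb_cons// big_ord_recl /= bin0 expr0 moment0 subn0 !mul1r.
have /= /andP[_ us'] := us.
move: s1; rewrite !big_cons /= => s1.
have s0 : 0 <= \sum_(x <- s) x.2 ^+ 2 by apply: sumr_ge0 => x _; exact: sqr_ge0.
have a2 := sqr_ge0 a.
apply: (le_trans (ler_normD _ _)).
rewrite [a ^+ 2 + _]addrC [K * _]mulrDr addrA; apply: lerD.
  by apply: ih => //; lra.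
rewrite /K mulr_suml; apply: (le_trans (ler_norm_sum _ _ _)).
apply: ler_sum => i _; rewrite !normrM normr_nat /bump /= add1n.
(* The term linear in [a] vanishes by centring; the others carry a power of [a] of order at least 2,
   bounded by [a ^+ 2] as [|a| <= 1]. *)
have [i0|i0] := eqVneq (nat_of_ord i) 0%N.
  by rewrite i0 W_mean normr0 !(mul0r, mulr0).
have rearrange (c x y z : R) : c * (x * y) * z = c * y * (z * x) by ring.
rewrite rearrange -[leRHS]mulrA ler_wpM2l ?mulr_ge0//; apply: ler_pM => //.
  apply: le_trans (ler_norm B); apply: hB => //; last by lra.
  by have := ltn_ord i; lia.
have a1 : `|a| <= 1.
  by rewrite -(@ler_pXn2r _ 2)// ?nnegrE// expr1n real_normK ?num_real//; lra.
rewrite -[a ^+ 2]real_normK ?num_real// normrX.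
by apply: ler_wiXn2l => //; lia.
Qed.

End moments_of_lincomb.

(** * Limits in L2 *)

Lemma cvge0_lt (R : realType) (e : nat -> \bar R) (r : R) :
  e N @[N --> \oo] --> 0%E -> 0 < r -> \forall N \near \oo, (e N < r%:E)%E.
Proof.
move=> /fine_cvgP[efin e0] r0; near=> N.
have eN : e N \is a fin_num by near: N.
rewrite -(fineK eN) lte_fin.
suff : `|0 - fine (e N)| < r by rewrite sub0r normrN; apply: le_lt_trans; exact: ler_norm.
by near: N; move/cvgrPdist_lt : e0 => /(_ _ r0).
Unshelve. all: by end_near. Qed.

(* Either [|x| <= 2|y|] or [|x| <= 2|x - y|]. *)
Lemma truncated_power_le (K : realFieldType) (M x y : K) (n : nat) : 1 <= M ->
  (if `|x| <= M then x ^+ (2 * n.+1) else 0) <=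
  4 ^+ n.+1 * y ^+ (2 * n.+1) + 4 * M ^+ (2 * n) * (x - y) ^+ 2.
Proof.
move=> M1; have y0 : 0 <= y ^+ (2 * n.+1) by rewrite exprM exprn_ge0 ?sqr_ge0.
have M0 : 0 <= M ^+ (2 * n) by rewrite exprn_ge0//; lra.
have d0 := sqr_ge0 (x - y).
have rhs1 : 0 <= 4 ^+ n.+1 * y ^+ (2 * n.+1) by rewrite mulr_ge0// exprn_ge0.
have rhs2 : 0 <= 4 * M ^+ (2 * n) * (x - y) ^+ 2 by rewrite mulr_ge0// mulr_ge0.
case: ifPn => [xM|_]; last by rewrite addr_ge0.
have [xy|xy] := leP `|x| (2 * `|y|).
  have x2 : x ^+ 2 <= 4 * y ^+ 2.
    rewrite -[x ^+ 2]real_normK ?num_real// -[y ^+ 2]real_normK ?num_real//.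
    have -> : 4 * `|y| ^+ 2 = (2 * `|y|) ^+ 2 by ring.
    by rewrite lerXn2r ?nnegrE ?mulr_ge0.
  by rewrite ler_wpDr// !exprM -exprMn lerXn2r ?nnegrE ?sqr_ge0// mulr_ge0 ?sqr_ge0.
rewrite ler_wpDl//.
have -> : (2 * n.+1 = 2 * n + 2)%N by lia.
have xx : x ^+ 2 <= 4 * (x - y) ^+ 2.
  rewrite -[x ^+ 2]real_normK ?num_real// -[(x - y) ^+ 2]real_normK ?num_real//.
  have -> : 4 * `|x - y| ^+ 2 = (2 * `|x - y|) ^+ 2 by ring.
  rewrite lerXn2r ?nnegrE ?mulr_ge0//.
  by have := ler_distD y x 0; rewrite !subr0; lra.
have xn : x ^+ (2 * n) <= M ^+ (2 * n).
  rewrite !exprM lerXn2r ?nnegrE ?sqr_ge0//.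
  by rewrite -[x ^+ 2]real_normK ?num_real// lerXn2r ?nnegrE//; lra.
rewrite exprD -[leRHS]mulrA [leRHS]mulrCA; apply: (@le_trans _ _ (M ^+ (2 * n) * x ^+ 2)).
  by rewrite ler_wpM2r ?sqr_ge0.
by rewrite ler_wpM2l.
Qed.

(** Factor out [x - y], bound the cofactor by the larger modulus and apply AM-GM with weight [t]. A
    weight small against bounded moments leaves only an L2 distance to control. *)
Lemma power_dist_le (K : realFieldType) (t x y : K) (n : nat) : 0 < t ->
  `|x ^+ n.+1 - y ^+ n.+1| <=
  t^-1 * (x - y) ^+ 2 + t * n.+1%:R ^+ 2 * (x ^+ (2 * n) + y ^+ (2 * n)).
Proof.
move=> t0; pose m := Num.max `|x| `|y|.
have m0 : 0 <= m by rewrite le_max normr_ge0.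
pose h := n.+1%:R * m ^+ n.
have h0 : 0 <= h by rewrite mulr_ge0 ?exprn_ge0.
have xyh : `|x ^+ n.+1 - y ^+ n.+1| <= `|x - y| * h.
  rewrite subrXX normrM ler_wpM2l//; apply: (le_trans (ler_norm_sum _ _ _)).
  rewrite /h mulr_natl -[X in _ <= _ *+ X](card_ord n.+1) -sumr_const.
  apply: ler_sum => i _; rewrite normrM !normrX /=.
  have -> : m ^+ n = m ^+ (n - i) * m ^+ i by rewrite -exprD subnK// -ltnS.
  by apply: ler_pM; rewrite ?exprn_ge0// lerXn2r ?nnegrE// le_max lexx ?orbT.
have hh : h ^+ 2 <= n.+1%:R ^+ 2 * (x ^+ (2 * n) + y ^+ (2 * n)).
  rewrite exprMn ler_wpM2l ?sqr_ge0// -exprM mulnC.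
  rewrite !exprM -[x ^+ 2]real_normK ?num_real// -[y ^+ 2]real_normK ?num_real//.
  have X0 : 0 <= (`|x| ^+ 2) ^+ n by rewrite exprn_ge0 ?sqr_ge0.
  have Y0 : 0 <= (`|y| ^+ 2) ^+ n by rewrite exprn_ge0 ?sqr_ge0.
  by rewrite /m; case: (leP `|x| `|y|) => _; lra.
apply: (le_trans xyh).
apply: (@le_trans _ _ (t^-1 * (x - y) ^+ 2 + t * h ^+ 2)); last first.
  by rewrite lerD2l -mulrA ler_wpM2l// ltW.
rewrite -[(x - y) ^+ 2]real_normK ?num_real//; move: `|x - y| => u.
have -> : t^-1 * u ^+ 2 + t * h ^+ 2 = t^-1 * (u ^+ 2 + (t * h) ^+ 2).
  by field; rewrite gt_eqF.
rewrite [leRHS]mulrC ler_pdivlMr//.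
by have := sqr_ge0 (u - t * h); have := sqr_ge0 (u + t * h); rewrite sqrrB sqrrD; lra.
Qed.

(** Young's inequality with a free weight: [1 + t] can be taken close to 1, so that a bound passes
    to an L2 limit without loss. *)
Lemma sqr_dist_le (K : realFieldType) (t x y z : K) : 0 < t ->
  (x - z) ^+ 2 <= (1 + t) * (y - z) ^+ 2 + (1 + t^-1) * (x - y) ^+ 2.
Proof.
move=> t0; have -> : x - z = (y - z) + (x - y) by ring.
move: (y - z) (x - y) => u v.
have : 0 <= t^-1 * (t * u - v) ^+ 2 by rewrite mulr_ge0 ?sqr_ge0// invr_ge0 ltW.
have -> : t^-1 * (t * u - v) ^+ 2 = t * u ^+ 2 + t^-1 * v ^+ 2 - 2 * (u * v).
  by field; rewrite gt_eqF.
by rewrite sqrrD; lra.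
Qed.

Section real_integrability.
Context {R : realType} {d : measure_display} {T : measurableType d}.
Variable P : probability T R.
Implicit Types f g : T -> R.

Local Notation real_integrable f := (P.-integrable setT (fun w => (f w)%:E)).

Lemma real_integrableD f g : real_integrable f -> real_integrable g ->
  real_integrable (fun w => f w + g w).
Proof. by move=> fi gi; exact: (integrableD measurableT fi gi). Qed.

Lemma real_integrableZ a f : real_integrable f -> real_integrable (fun w => a * f w).
Proof. by move=> fi; exact: (integrableZl measurableT a fi). Qed.

Lemma real_integrable_le f g : measurable_fun setT f ->
  (forall w, `|f w| <= g w) -> real_integrable g -> real_integrable f.
Proof.
move=> mf fg; apply: le_integrable => //; first exact/measurable_EFinP.
by move=> w _; rewrite lee_fin (le_trans (fg w))// ler_norm.
Qed.

Lemma Rintegral_linD a b f g : real_integrable f -> real_integrable g ->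
  \int[P]_w (a * f w + b * g w) = a * \int[P]_w f w + b * \int[P]_w g w.
Proof.
move=> fi gi; rewrite RintegralD//; last 2 first.
- exact: real_integrableZ.
- exact: real_integrableZ.
by rewrite !RintegralZl.
Qed.

Lemma Rintegral_le f g : measurable_fun setT f -> (forall w, `|f w| <= g w) ->
  real_integrable g -> `|\int[P]_w f w| <= \int[P]_w g w.
Proof.
move=> mf fg gi; have fi := real_integrable_le mf fg gi.
apply: (le_trans (le_normr_Rintegral measurableT fi)).
by apply: le_Rintegral => //; exact: integrable_norm.
Qed.

Lemma all_moments_sqrB (X Y : {RV P >-> R}) : all_moments P X -> all_moments P Y ->
  real_integrable (fun w => (X w - Y w) ^+ 2).
Proof.
move=> mX mY.
apply: (@real_integrable_le _ (fun w => 2 * X w ^+ 2 + 2 * Y w ^+ 2)).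
- by apply: measurable_funX; exact: measurable_funB.
- move=> w; rewrite ger0_norm ?sqr_ge0//.
  by have := sqr_ge0 (X w + Y w); rewrite sqrrB sqrrD; lra.
- by apply: real_integrableD; apply: real_integrableZ; [exact: mX|exact: mY].
Qed.

End real_integrability.

Section L2_limit.
Context {R : realType} {d : measure_display} {T : measurableType d}.
Context {P : probability T R}.
Variables (S : nat -> {RV P >-> R}) (F : {RV P >-> R}).

Hypothesis S_moments : forall N, all_moments P (S N).
Hypothesis S_bounded : forall n, exists B, forall N, `|moment P (S N) n| <= B.
Hypothesis SF : 'E_P[fun w => ((F w - S N w) ^+ 2)%R]%E @[N --> \oo] --> 0%E.

(** The bound is independent of the truncation level because [S N] is chosen after [M]: its L2 error
    is so small that the factor [c], which grows with [M], is absorbed into the added 1. *)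
Lemma L2_limit_truncated_even_moment n : exists B, forall M,
  (\int[P]_w (if `|F w| <= M%:R then F w ^+ (2 * n.+1) else 0)%:E <= B%:E)%E.
Proof.
have [B hB] := S_bounded (2 * n.+1).
exists (4 ^+ n.+1 * B + 1) => M.
pose K : R := Num.max 1 M%:R.
pose c : R := 4 * K ^+ (2 * n).
have K1 : 1 <= K by rewrite le_max lexx.
have c0 : 0 < c by rewrite mulr_gt0// exprn_gt0//; lra.
have c_inv0 : 0 < c^-1 by rewrite invr_gt0.
have [N _ /(_ N (leqnn _)) eN] := cvge0_lt SF c_inv0.
have F0 w : 0 <= F w ^+ (2 * n.+1) by rewrite exprM exprn_ge0 ?sqr_ge0.
have trunc w : (if `|F w| <= M%:R then F w ^+ (2 * n.+1) else 0) <=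
    4 ^+ n.+1 * S N w ^+ (2 * n.+1) + c * (F w - S N w) ^+ 2.
  apply: le_trans (truncated_power_le _ _ _ K1).
  case: ifPn => [FM|_]; last by case: ifP.
  by rewrite (le_trans FM)// le_max lexx orbT.
move: c c0 c_inv0 eN trunc => c c0 c_inv0 eN trunc.
have S0 w : (0 <= S N w ^+ (2 * n.+1))%R by rewrite exprM exprn_ge0 ?sqr_ge0.
have mS : measurable_fun setT (fun w => S N w ^+ (2 * n.+1)) by exact: measurable_funX.
have mD : measurable_fun setT (fun w => (F w - S N w) ^+ 2).
  by apply: measurable_funX; exact: measurable_funB.
apply: (@le_trans _ _ (\int[P]_w (4 ^+ n.+1 * S N w ^+ (2 * n.+1) +
    c * (F w - S N w) ^+ 2)%:E)%E).
  apply: ge0_le_integral => //.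
  - by move=> w _; rewrite lee_fin; case: ifP.
  - apply/measurable_EFinP; apply: measurable_fun_ifT => //.
      apply: measurable_fun_ler => //; exact: measurableT_comp.
    exact: measurable_funX.
  - apply/measurable_EFinP; apply: measurable_funD; exact: measurable_funM.
  - by move=> w _; rewrite lee_fin.
under eq_integral => w _ do rewrite EFinD EFinM [X in (_ + X)%E]EFinM.
rewrite ge0_integralD//; last 4 first.
- by move=> w _; rewrite mule_ge0// lee_fin.
- by apply: measurable_funeM; exact/measurable_EFinP.
- by move=> w _; rewrite mule_ge0// lee_fin ?sqr_ge0// ltW.
- by apply: measurable_funeM; exact/measurable_EFinP.
rewrite !ge0_integralZl//; try exact/measurable_EFinP; last 3 first.
- by move=> w _; rewrite lee_fin sqr_ge0.
- by rewrite lee_fin ltW.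
- by move=> w _; rewrite lee_fin.
rewrite EFinD; apply: leeD.
  rewrite EFinM lee_wpmul2l ?lee_fin ?exprn_ge0//.
  have Sfin := integrable_fin_num measurableT (S_moments N (2 * n.+1)).
  rewrite -(fineK Sfin) lee_fin; apply: le_trans (hB N).
  by rewrite momentE ler_norm.
move: eN; rewrite unlock => /ltW eN.
apply: (@le_trans _ _ (c%:E * c^-1%:E)%E).
  by rewrite lee_wpmul2l// lee_fin ltW.
by rewrite -EFinM divff ?gt_eqF.
Qed.

(** Monotone convergence lifts the truncation for even exponents; any [p] follows from
    [|x|^p <= 1 + x^(2(p+1))]. *)
Lemma L2_limit_all_moments : all_moments P F.
Proof.
have even n : P.-integrable setT (fun w => (F w ^+ (2 * n.+1))%:E).
  have F0 w : (0 <= F w ^+ (2 * n.+1))%R by rewrite exprM exprn_ge0 ?sqr_ge0.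
  have [B hB] := L2_limit_truncated_even_moment n.
  apply/integrableP; split; first by apply/measurable_EFinP; exact: measurable_funX.
  under eq_integral do rewrite gee0_abs ?lee_fin//.
  pose g M w : \bar R := (if `|F w| <= M%:R then F w ^+ (2 * n.+1) else 0)%:E.
  have gcvg w : g M w @[M --> \oo] --> (F w ^+ (2 * n.+1))%:E.
    apply: cvg_near_cst; near=> M; rewrite /g ifT//.
    by near: M; exact: nbhs_infty_ger.
  have mono : (\int[P]_w g M w)%E @[M --> \oo] --> (\int[P]_w (F w ^+ (2 * n.+1))%:E)%E.
    have -> : (\int[P]_w (F w ^+ (2 * n.+1))%:E = \int[P]_w limn (g ^~ w))%E.
      by apply: eq_integral => w _; apply/esym/cvg_lim => //; exact: gcvg.
    apply: cvg_monotone_convergence => //.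
    - move=> M; apply/measurable_EFinP; apply: measurable_fun_ifT => //.
        apply: measurable_fun_ler => //; exact: measurableT_comp.
      exact: measurable_funX.
    - by move=> M w _; rewrite /g lee_fin; case: ifP.
    - move=> w _ M M' MM'; rewrite /g lee_fin.
      case: ifPn => [FM|_]; last by case: ifP.
      by rewrite (le_trans FM)// ler_nat.
  apply: (@le_lt_trans _ _ B%:E); last exact: ltry.
  rewrite -(cvg_lim _ mono)//; apply: lime_le; first by apply/cvg_ex; eexists; exact: mono.
  by near=> M; exact: hB.
move=> p; apply: (@real_integrable_le _ _ _ _ _ (fun w => 1 + F w ^+ (2 * p.+1))).
- exact: measurable_funX.
- move=> w; rewrite normrX exprM -[F w ^+ 2]real_normK ?num_real// -exprM.
  have [Fw|Fw] := leP `|F w| 1.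
    by rewrite ler_wpDr ?exprn_ge0// exprn_ile1.
  by rewrite ler_wpDl//; apply: ler_weXn2l; [exact: ltW|lia].
- apply: real_integrableD => //; exact: finite_measure_integrable_cst.
Unshelve. all: by end_near. Qed.

Let dist N := \int[P]_w ((F w - S N w) ^+ 2).

Lemma L2_limit_dist_lt (r : R) : 0 < r -> \forall N \near \oo, dist N < r.
Proof.
move=> r0; near=> N.
have Nr : ('E_P[fun w => ((F w - S N w) ^+ 2)%R] < r%:E)%E.
  by near: N; exact: cvge0_lt SF r0.
have fin := integrable_fin_num measurableT
  (all_moments_sqrB L2_limit_all_moments (S_moments N)).
by move: Nr; rewrite unlock -(fineK fin) lte_fin.
Unshelve. all: by end_near. Qed.

(** [power_dist_le] reduces this to the L2 distance and to moments of order [2 * n], finite for [F]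
    and bounded along the sequence. *)
Lemma L2_limit_moment n : moment P (S N) n @[N --> \oo] --> moment P F n.
Proof.
case: n => [|n].
  by under eq_fun do rewrite moment0; rewrite moment0; exact: cvg_cst.
have [B hB] := S_bounded (2 * n).
have F0 : 0 <= moment P F (2 * n).
  by rewrite momentE; apply: Rintegral_ge0 => w _; rewrite exprM exprn_ge0 ?sqr_ge0.
have B0 : 0 <= B by apply: le_trans (hB 0%N).
pose c := n.+1%:R ^+ 2 * (moment P F (2 * n) + B).
have c0 : 0 <= c by rewrite mulr_ge0 ?sqr_ge0 ?addr_ge0.
apply/cvgrPdist_le => e e0.
(* Makes the moment part [t * c] at most [e / 2]; [N] is then taken so that the distance part is
   too. The added 1 allows [c = 0]. *)
pose t := e / (2 * (c + 1)).
have t0 : 0 < t by rewrite divr_gt0//; lra.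
near=> N.
have Nt : dist N < t * (e / 2).
  by near: N; apply: L2_limit_dist_lt; rewrite mulr_gt0// divr_gt0.
have FN := all_moments_sqrB L2_limit_all_moments (S_moments N).
have sumI := real_integrableD (L2_limit_all_moments (2 * n)) (S_moments N (2 * n)).
rewrite !momentE -RintegralB//; last 2 first.
- exact: L2_limit_all_moments.
- exact: S_moments.
apply: le_trans (Rintegral_le (g := fun w => t^-1 * (F w - S N w) ^+ 2 +
    t * n.+1%:R ^+ 2 * (F w ^+ (2 * n) + S N w ^+ (2 * n))) _ _ _) _.
- by apply: measurable_funB; exact: measurable_funX.
- by move=> w; exact: power_dist_le.
- by apply: real_integrableD; exact: real_integrableZ.
rewrite Rintegral_linD// RintegralD//; last 2 first.
- exact: L2_limit_all_moments.
- exact: S_moments.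
rewrite -/(dist N) -!momentE.
have d2 : t^-1 * dist N <= e / 2 by rewrite mulrC ler_pdivrMr// mulrC ltW.
have m2 : t * n.+1%:R ^+ 2 * (moment P F (2 * n) + moment P (S N) (2 * n)) <= t * c.
  rewrite -mulrA ler_wpM2l ?(ltW t0)// /c ler_wpM2l ?sqr_ge0// lerD2l.
  exact: le_trans (ler_norm _) (hB N).
have tc : t * c <= e / 2.
  have : t * (2 * (c + 1)) = e by rewrite /t divfK// gt_eqF//; lra.
  lra.
lra.
Unshelve. all: by end_near. Qed.

Lemma L2_limit_cumulant r : cumulant P (S N) r @[N --> \oo] --> cumulant P F r.
Proof.
rewrite cumulantE; under eq_fun do rewrite cumulantE.
apply: cvgMr; apply: cvg_log1p_trunc => i.
rewrite coef_poly; under eq_fun do rewrite coef_poly.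
case: ltnP => _; last exact: cvg_cst.
case: eqP => _; first exact: cvg_cst.
by apply: cvgMl; exact: L2_limit_moment.
Qed.

Lemma L2_limit_dist_le (G : {RV P >-> R}) (V : R) (N0 : nat) : all_moments P G ->
  (forall N, (N0 <= N)%N -> \int[P]_w ((S N w - G w) ^+ 2) <= V) ->
  \int[P]_w ((F w - G w) ^+ 2) <= V.
Proof.
move=> mG hV; have mF := L2_limit_all_moments.
have V0 : 0 <= V.
  by apply: le_trans (hV N0 (leqnn _)); apply: Rintegral_ge0 => w _; exact: sqr_ge0.
apply/ler_addgt0Pr => e e0.
(* Chosen so that [(1 + t) * V + t = V + e]; the last [t] pays for the distance from [F] to
   [S N]. *)
pose t := e / (V + 1).
have t0 : 0 < t by rewrite divr_gt0//; lra.
have t1 : 0 < 1 + t^-1 by have : 0 < t^-1 by [rewrite invr_gt0]; lra.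
have [N1 _ hN1] := L2_limit_dist_lt (divr_gt0 t0 t1).
pose N := maxn N0 N1.
have dN := hN1 N (leq_maxr _ _).
have SG := hV N (leq_maxl _ _).
have iSG := all_moments_sqrB (S_moments N) mG.
have iFS := all_moments_sqrB mF (S_moments N).
apply: (@le_trans _ _ ((1 + t) * \int[P]_w ((S N w - G w) ^+ 2) + (1 + t^-1) * dist N)).
  rewrite -Rintegral_linD//; apply: le_Rintegral => //.
  - exact: all_moments_sqrB.
  - by apply: real_integrableD; exact: real_integrableZ.
  - by move=> w _; exact: sqr_dist_le.
have h1 : (1 + t^-1) * dist N <= t by rewrite mulrC -ler_pdivlMr// ltW.
have h2 : (1 + t) * \int[P]_w ((S N w - G w) ^+ 2) <= (1 + t) * V.
  by rewrite ler_wpM2l//; lra.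
have h3 : t * (V + 1) = e by rewrite /t divfK// gt_eqF//; lra.
lra.
Qed.

End L2_limit.

(** * Couplings *)

Lemma wasserstein2_le (R : realType) (d1 d2 : measure_display)
    (T1 : measurableType d1) (T2 : measurableType d2)
    (P1 : probability T1 R) (P2 : probability T2 R)
    (X Y : {RV P1 >-> R}) (G : {RV P2 >-> R}) (v : R) : 0 <= v ->
  P1.-integrable setT (fun w => ((X w - Y w) ^+ 2)%:E) ->
  same_law Y G -> \int[P1]_w ((X w - Y w) ^+ 2) <= v ^+ 2 ->
  (wasserstein2 X G <= v%:E)%E.
Proof.
move=> v0 iXY YG XYv; have -> : v%:E = sqrte (v ^+ 2)%:E.
  by rewrite EFin_expe sqrte_sqr gee0_abs.
rewrite lee_sqrt ?lee_fin ?sqr_ge0//.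
apply: ge_ereal_inf; exists 'E_P1[fun w => (`|X w - Y w| ^+ 2)%R]%E.
  by exists d1, T1, P1, X, Y.
rewrite unlock; under eq_integral do rewrite real_normK ?num_real//.
by rewrite -(fineK (integrable_fin_num measurableT iXY)) lee_fin.
Qed.

Section convergence_in_distribution.
Context {R : realType} {d : measure_display} {T : measurableType d}.
Context {P : probability T R}.

(** If [X <= x], then [Y <= x + eta] or the two differ by at least [eta]; Markov's inequality for
    the square bounds the second case. *)
Lemma fine_cdf_le_shift (X Y : {RV P >-> R}) (x eta v : R) : 0 < eta ->
  P.-integrable setT (fun w => ((X w - Y w) ^+ 2)%:E) ->
  \int[P]_w ((X w - Y w) ^+ 2) <= v ->
  fine (cdf X x) <= fine (cdf Y (x + eta)) + v / eta ^+ 2.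
Proof.
move=> eta0 iXY XYv; pose A := [set w | eta <= `|X w - Y w|].
have mA : measurable A.
  have mf : measurable_fun setT (fun w => `|X w - Y w|).
    by apply: measurableT_comp => //; exact: measurable_funB.
  rewrite -[A]setTI; have := mf measurableT _ (measurable_itv `[eta, +oo[).
  by congr measurable; apply/seteqP; split => w [_ /=]; rewrite in_itv/= andbT.
have mcdf (Z : {RV P >-> R}) z : measurable (Z @^-1` `]-oo, z]).
  exact: measurable_funPTI.
have pA : (P A <= (v / eta ^+ 2)%:E)%E.
  rewrite EFinM muleC lee_pdivlMl ?exprn_gt0//.
  have sqr_mono : {in Num.nneg &, {homo (fun r : R => r ^+ 2) : r s / r <= s}}.
    by move=> r s r0 s0 rs; rewrite lerXn2r.
  have := markov (X - Y : {RV P >-> R}) eta0 (exprn_measurable 2)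
    (fun r _ => sqr_ge0 r) sqr_mono.
  move=> /le_trans; apply.
  rewrite unlock; under eq_integral do rewrite /= real_normK ?num_real//.
  by rewrite -(fineK (integrable_fin_num measurableT iXY)) lee_fin.
rewrite -lee_fin EFinD.
apply: (@le_trans _ _ (P (Y @^-1` `]-oo, (x + eta)%R] `|` A))).
  rewrite fineK ?fin_num_measure//; apply: (le_measure P); rewrite ?inE//.
    by apply: measurableU.
  move=> w /=; rewrite !in_itv /= => Xx.
  have [|h] := leP eta `|X w - Y w|; first by right.
  by left; have := ler_norm (Y w - X w); rewrite distrC; lra.
apply: (le_trans (measureU2 _ _ _)) => //.
by rewrite leeD ?fineK ?fin_num_measure.
Qed.

(** The copy [G] may change with [n], as only its distribution function enters. Comparison at
    [x - eta] and [x + eta] and continuity at [x] squeeze [cdf (F n) x]. *)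
Lemma cvg_in_distribution_coupling (F : nat -> {RV P >-> R}) (F0 : {RV P >-> R})
    (v : nat -> R) : v n @[n --> \oo] --> (0 : R) ->
  (\forall n \near \oo, exists G : {RV P >-> R}, [/\ same_law G F0,
     P.-integrable setT (fun w => ((F n w - G w) ^+ 2)%:E) &
     \int[P]_w ((F n w - G w) ^+ 2) <= v n]) ->
  cvg_in_distribution F F0.
Proof.
move=> v0 couple x cx.
have fin (Z : {RV P >-> R}) z : cdf Z z \is a fin_num by exact: fin_num_measure.
rewrite -(fineK (fin F0 x)); apply/fine_cvgP; split; first by near=> n.
have {}cx : fine (cdf F0 y) @[y --> x] --> fine (cdf F0 x).
  by apply: fine_cvg; rewrite fineK//; exact: cx.
apply/cvgrPdist_le => e e0.
have e2 : 0 < e / 2 by rewrite divr_gt0.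
move/cvgrPdist_le : cx => /(_ _ e2) /nbhs_ballP[r /= r0 hr].
pose eta := r / 2.
have eta0 : 0 < eta by rewrite divr_gt0.
have [h1 h2] : `|fine (cdf F0 x) - fine (cdf F0 (x + eta))| <= e / 2 /\
    `|fine (cdf F0 x) - fine (cdf F0 (x - eta))| <= e / 2.
  split; apply: hr; rewrite /ball /=.
    by rewrite opprD addrA subrr add0r normrN gtr0_norm// /eta; lra.
  by rewrite opprB addrCA subrr addr0 gtr0_norm// /eta; lra.
near=> n.
have [G [GF iFG FGv]] : exists G : {RV P >-> R}, [/\ same_law G F0,
     P.-integrable setT (fun w => ((F n w - G w) ^+ 2)%:E) &
     \int[P]_w ((F n w - G w) ^+ 2) <= v n] by near: n.
have cdfG z : cdf G z = cdf F0 z by exact: GF.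
have vn : v n / eta ^+ 2 <= e / 2.
  rewrite ler_pdivrMr ?exprn_gt0//; apply/ltW.
  apply: (le_lt_trans (ler_norm _)); rewrite -[v n]subr0 distrC.
  near: n; move/cvgrPdist_lt : v0; apply.
  by rewrite mulr_gt0// exprn_gt0.
have le1 := fine_cdf_le_shift x eta0 iFG FGv.
have sq w : (F n w - G w) ^+ 2 = (G w - F n w) ^+ 2 by rewrite -sqrrN opprB.
have le2 : fine (cdf F0 (x - eta)) <= fine (cdf (F n) x) + v n / eta ^+ 2.
  rewrite -cdfG -[x in cdf (F n) x](subrK eta); apply: fine_cdf_le_shift => //.
    by under eq_fun do rewrite -sq.
  by under eq_Rintegral do rewrite -sq.
move: le1 le2; rewrite cdfG; move: h1 h2; rewrite !ler_norml /=; lra.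
Unshelve. all: by end_near. Qed.

End convergence_in_distribution.

(** * Infinite sums of i.i.d. variables *)

(* [measurableTypeR R] and [R] are distinct measurable types with the same
   measurable sets; [id_rv] transports [mu] from the former to the latter. *)
Definition id_rv (R : realType) : measurableTypeR R -> R := idfun.

HB.instance Definition _ (R : realType) := @isMeasurableFun.Build _ _ _ _
  (@id_rv R) (@measurable_id _ _ setT).

Section iid_sums.
Context {R : realType} {d : measure_display} {T : measurableType d}.
Context {P : probability T R}.
Variables (mu : probability (measurableTypeR R) R) (W : nat -> {RV P >-> R}).
Hypothesis W_iid : iid_with_law mu W.
Hypothesis W_moments : all_moments P (W 0%N).

Lemma iid_same_law j k : same_law (W j) (W k).
Proof. by move=> A mA; rewrite !(W_iid.2). Qed.

(** This lets the constants of the theorem be computed from [mu], before any probability space is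
    given. *)
Lemma iid_cumulant r : cumulant P (W 0%N) r = cumulant mu (@id_rv R) r.
Proof.
apply: eq_moment_cumulant => n; apply: same_law_moment => // A mA.
exact: W_iid.2.
Qed.

Hypothesis W_mean : moment P (W 0%N) 1 = 0.
Hypothesis W_var : moment P (W 0%N) 2 = 1.

Variables (a : nat -> R) (F : {RV P >-> R}).
Hypothesis a_sqr : series (fun k => a k ^+ 2) @ \oo --> (1 : R).
Hypothesis F_sum : L2_sum (fun k => a k *: W k) F.

Let terms (b : nat -> R) N := [seq (k, b k) | k <- iota 0 N].

Let terms_uniq b N : uniq (unzip1 (terms b N)).
Proof. by rewrite /unzip1 -map_comp map_id iota_uniq. Qed.

Let sum_terms b N r : \sum_(x <- terms b N) x.2 ^+ r = series (fun k => b k ^+ r) N.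
Proof. by rewrite big_map /series /= /index_iota subn0. Qed.

Let S N := lincomb W (terms a N).

Let S_moments N : all_moments P (S N).
Proof.
by apply: lincomb_all_moments => //; [exact: W_iid.1|exact: iid_same_law].
Qed.

Lemma sqr_partial_le1 N : series (fun k => a k ^+ 2) N <= 1.
Proof.
rewrite -(cvg_lim (@Rhausdorff R) a_sqr); apply: nondecreasing_cvgn_le.
  by apply: nondecreasing_series => k _ _; exact: sqr_ge0.
by apply/cvg_ex; exists 1.
Qed.

Let S_bounded n : exists B, forall N, `|moment P (S N) n| <= B.
Proof.
have [B hB] := moment_lincomb_bounded W_iid.1 iid_same_law W_moments W_mean n.
by exists B => N; apply: hB => //; rewrite sum_terms sqr_partial_le1.
Qed.

Let S_cvg : 'E_P[fun w => ((F w - S N w) ^+ 2)%R]%E @[N --> \oo] --> 0%E.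
Proof.
have -> : (fun N => 'E_P[fun w => ((F w - S N w) ^+ 2)%R]%E) =
  (fun N => 'E_P[fun w => ((F w - \sum_(0 <= k < N) (a k *: W k) w) ^+ 2)%R]%E).
  apply/funext => N; congr ('E_P[_])%E; apply/funext => w.
  by rewrite /S lincombE big_map /index_iota subn0.
exact: F_sum.
Qed.

Lemma iid_sum_all_moments : all_moments P F.
Proof. exact: (L2_limit_all_moments S_moments S_bounded S_cvg). Qed.

Lemma iid_sum_moment2 : moment P F 2 = 1.
Proof.
have SE : (fun N => moment P (S N) 2) = series (fun k => a k ^+ 2).
  apply/funext => N.
  by rewrite (moment2_lincomb W_iid.1 iid_same_law W_moments W_mean)// sum_terms.
have := L2_limit_moment S_moments S_bounded S_cvg (n := 2); rewrite SE => F2.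
exact: (cvg_unique (@Rhausdorff R) F2 a_sqr).
Qed.

(** The cumulants of the partial sums are the partial power sums times a nonzero factor, so
    convergence of the series is an outcome of the L2 limit. *)
Lemma iid_sum_power_sums r : (0 < r)%N -> cumulant P (W 0%N) r != 0 ->
  series (fun k => a k ^+ r) @ \oo --> cumulant P F r / cumulant P (W 0%N) r.
Proof.
move=> r0 kr0; have := L2_limit_cumulant S_moments S_bounded S_cvg (r := r).
have -> : (fun N => cumulant P (S N) r) =
    (fun N => cumulant P (W 0%N) r * series (fun k => a k ^+ r) N).
  apply/funext => N.
  by rewrite (cumulant_lincomb W_iid.1 iid_same_law W_moments)// sum_terms.
move=> h; have -> : series (fun k => a k ^+ r) = (fun N =>
    cumulant P (W 0%N) r * series (fun k => a k ^+ r) N / cumulant P (W 0%N) r).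
  by apply/funext => N; rewrite mulrAC divff// mul1r.
by apply: cvgMl.
Qed.

Variables (q : nat) (b : 'I_q -> R).

(** Once [N] exceeds every [k r], the partial sum minus [G] is one combination of the first [N]
    variables, whose second moment is the sum of its squared coefficients; the bound then passes to
    [F]. *)
Lemma iid_sum_dist (k : 'I_q -> nat) (V : R) : injective k ->
  (forall N, \sum_(j < N) (a j - \sum_r (k r == j)%:R * b r) ^+ 2 <= V) ->
  let G := lincomb W [seq (k r, b r) | r <- enum 'I_q] in
  all_moments P G /\ \int[P]_w ((F w - G w) ^+ 2) <= V.
Proof.
move=> k_inj hV G.
have mG : all_moments P G.
  apply: lincomb_all_moments => //; [exact: W_iid.1|exact: iid_same_law|].
  by rewrite /unzip1 -map_comp map_inj_uniq ?enum_uniq.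
split=> //.
pose c j := \sum_r (k r == j)%:R * b r.
apply: (L2_limit_dist_le S_moments S_bounded S_cvg (N0 := \max_r (k r).+1)) => // N kN.
have GE w : G w = \sum_(j < N) c j * W j w.
  rewrite /G lincombE big_map big_enum /=.
  under [RHS]eq_bigr do rewrite /c mulr_suml.
  rewrite exchange_big /=; apply: eq_bigr => r _.
  have kr : (k r < N)%N by apply: leq_trans kN; exact: (leq_bigmax r).
  rewrite (bigD1 (Ordinal kr))//= eqxx mul1r big1 ?addr0// => j jk.
  have /negPf -> : k r != j by apply: contra_neq jk => kj; exact: val_inj.
  by rewrite mulr0n !mul0r.
have -> : \int[P]_w ((S N w - G w) ^+ 2) =
    moment P (lincomb W (terms (fun j => a j - c j) N)) 2.
  rewrite momentE; apply: eq_Rintegral => w _; congr (_ ^+ 2).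
  rewrite GE /S !lincombE !big_map -[N in iota 0 N]subn0 -/(index_iota 0 N) !big_mkord.
  by rewrite -sumrB; apply: eq_bigr => j _ /=; rewrite mulrBl.
rewrite (moment2_lincomb W_iid.1 iid_same_law W_moments W_mean)// sum_terms.
by rewrite /series /= big_mkord; exact: hV.
Qed.

End iid_sums.

(** * Proof of the theorem *)

(** The value of [limn] is meaningful only for a convergent sequence. Here the terms are nonnegative
    and dominated by [4 ^+ q * a k ^+ 2], all points lying in [-1, 1], so the partial sums increase
    to their limit. *)
Lemma Delta_ge_partial (R : realType) (q : nat) (aoo : 'I_q -> R) (a : nat -> R) :
  (forall r, `|aoo r| <= 1) -> (forall N, series (fun k => a k ^+ 2) N <= 1) ->
  forall N, series (fun k => a k ^+ 2 * \prod_(r < q) (a k - aoo r) ^+ 2) N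
            <= Delta aoo a.
Proof.
move=> aoo1 a1.
have a_le1 k : `|a k| <= 1.
  rewrite -(@ler_pXn2r _ 2)// ?nnegrE// expr1n real_normK ?num_real//.
  apply: le_trans (a1 k.+1); rewrite seriesSr lerDr.
  by apply: sumr_ge0 => i _; exact: sqr_ge0.
have term0 k : 0 <= a k ^+ 2 * \prod_(r < q) (a k - aoo r) ^+ 2.
  by rewrite mulr_ge0 ?sqr_ge0// prodr_ge0// => r _; exact: sqr_ge0.
have term_le k : a k ^+ 2 * \prod_(r < q) (a k - aoo r) ^+ 2 <= 4 ^+ q * a k ^+ 2.
  rewrite mulrC ler_wpM2r ?sqr_ge0// -[X in 4 ^+ X](card_ord q) -prodr_const.
  apply: ler_prod => r _; rewrite sqr_ge0 /= -[leLHS]real_normK ?num_real//.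
  have -> : (4 : R) = 2 ^+ 2 by ring.
  rewrite lerXn2r ?nnegrE//.
  by apply: (le_trans (ler_normB _ _)); have := aoo1 r; have := a_le1 k; lra.
have nd : nondecreasing_seq (series (fun k => a k ^+ 2 * \prod_(r < q) (a k - aoo r) ^+ 2)).
  by apply: nondecreasing_series => k _ _.
move=> N; apply: nondecreasing_cvgn_le => //.
apply: nondecreasing_is_cvgn => //; exists (4 ^+ q) => _ [M _ <-].
apply: (@le_trans _ _ (4 ^+ q * series (fun k => a k ^+ 2) M)).
  by rewrite /series /= mulr_sumr; apply: ler_sum => k _.
by rewrite ler_piMr// exprn_ge0.
Qed.

Theorem theorem3p1 (R : realType) (q : nat) (hq : (2 <= q)%N)
    (mu : probability (measurableTypeR R) R)
    (aoo : 'I_q -> R) (aoo_neq0 : forall i, aoo i != 0)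
    (aoo_inj : injective aoo) (aoo_sqr : \sum_(i < q) aoo i ^+ 2 = 1) :
  exists C0 U C : R, [/\ 0 < C0, 0 < U, 0 < C &
  forall (d : measure_display) (T : measurableType d) (P : probability T R)
         (W : nat -> {RV P >-> R}) (alpha : nat -> nat -> R)
         (F : nat -> {RV P >-> R}),
    iid_with_law mu W ->
    (forall p : nat, P.-integrable setT (fun w => (W 0%N w ^+ p)%:E)) ->
    ('E_P[W 0%N] = 0)%E ->
    ('E_P[fun w => (W 0%N w ^+ 2)%R] = 1)%E ->
    (forall r : nat, (2 <= r <= q.+1)%N -> cumulant P (W 0%N) r != 0) ->
    (forall n, series (fun k => alpha n k ^+ 2) @ \oo --> (1 : R)) ->
    (forall n, L2_sum (fun k => alpha n k *: W k) (F n)) ->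
    let Foo : {RV P >-> R} := \sum_(i < q) aoo i *: W i in
    let D n := Num.sqrt (Delta aoo (alpha n)) in
    let K n := \sum_(2 <= r < q.+2)
                 `|cumulant P (F n) r - cumulant P Foo r| in
    [/\ forall n, (wasserstein2 (F n) Foo <= (C0 * (D n + K n))%:E)%E,
        forall n, D n + K n <= U ->
          (wasserstein2 (F n) Foo <= (C * D n)%:E)%E &
        Delta aoo (alpha n) @[n --> \oo] --> (0 : R) ->
        (forall r : nat, (2 <= r <= q.+1)%N ->
          cumulant P (F n) r @[n --> \oo] --> cumulant P Foo r) ->
        [/\ \forall n \near \oo, D n + K n <= U,
            \forall n \near \oo, (wasserstein2 (F n) Foo <= (C * D n)%:E)%E &
            cvg_in_distribution F Foo]]].
Proof.
have idx_lt r : (2 <= r <= q.+1)%N -> (r - 2 < q)%N by lia.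
have idx_sub r : (2 <= r <= q.+1)%N -> (r - 2 + 2 = r)%N by lia.
have idx_gt0 r : (2 <= r <= q.+1)%N -> (0 < r)%N by lia.
have aoo_le1 r : `|aoo r| <= 1.
  rewrite -(@ler_pXn2r _ 2)// ?nnegrE// expr1n real_normK ?num_real//.
  rewrite -aoo_sqr (bigD1 r)//= lerDl.
  by apply: sumr_ge0 => i _; exact: sqr_ge0.
have [U0 [c [U0_gt0 c_gt0 rigid]]] := power_sums_rigidity hq aoo_inj aoo_neq0 aoo_le1.
pose kap r := cumulant mu (@id_rv R) r.
(* The constants are chosen before the cumulants are known to be nonzero, hence the placeholder
   1. *)
have kap_gt0 (i : 'I_q) : 0 < if kap (i + 2)%N == 0 then 1 else `|kap (i + 2)%N|.
  by case: eqVneq => //; rewrite normr_gt0.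
have [m [m_gt0 m_le1 m_le]] := fin_pos_lower_bound kap_gt0.
(* A cumulant gap of at most [U], divided by a cumulant of [W] of modulus at least [m], is a power
   sum gap of at most [U0]; [m <= 1] also gives [D n <= U0]. *)
pose U := m * U0; pose C := Num.sqrt c.
have U_gt0 : 0 < U by rewrite mulr_gt0.
have C_gt0 : 0 < C by rewrite sqrtr_gt0.
(* [C] serves below the threshold; above it [D n + K n > U], so [2 / U] lifts the right side above
   the trivial bound 2. *)
exists (C + 2 / U), U, C; split => //; first by rewrite addr_gt0// divr_gt0.
move=> d T P W alpha F W_iid W_mom EW0 EW2 kap_neq0 alpha_sqr F_sum Foo D K.
have W_mean : moment P (W 0%N) 1 = 0.
  by rewrite /moment (_ : (fun w => _) = W 0%N :> (T -> R)) ?EW0.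
have W_var : moment P (W 0%N) 2 = 1 by rewrite /moment EW2.
have W_indep := W_iid.1.
have W_law := iid_same_law W_iid.
have D_ge0 n : 0 <= D n by exact: sqrtr_ge0.
have K_ge0 n : 0 <= K n by apply: sumr_ge0.
have FooE : Foo = lincomb W [seq (nat_of_ord r, aoo r) | r <- enum 'I_q].
  by rewrite /lincomb big_map big_enum.
have Foo_uniq : uniq (unzip1 [seq (nat_of_ord r, aoo r) | r <- enum 'I_q]).
  by rewrite /unzip1 -map_comp map_inj_uniq ?enum_uniq//; exact: val_inj.
have Foo_mom : all_moments P Foo by rewrite FooE; exact: lincomb_all_moments.
have F_mom n : all_moments P (F n).
  exact: (iid_sum_all_moments W_iid W_mom W_mean (alpha_sqr n) (F_sum n)).
have partial n := Delta_ge_partial aoo_le1 (sqr_partial_le1 (alpha_sqr n)).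
have Delta_ge0 n : 0 <= Delta aoo (alpha n).
  by apply: le_trans (partial n 0%N); rewrite /series /= big_nil.
have D_sqr n : D n ^+ 2 = Delta aoo (alpha n) by rewrite sqr_sqrtr.
have coupling n : D n + K n <= U -> exists G : {RV P >-> R},
    [/\ same_law G Foo, P.-integrable setT (fun w => ((F n w - G w) ^+ 2)%:E) &
        \int[P]_w ((F n w - G w) ^+ 2) <= (C * D n) ^+ 2].
  move=> DKU.
  have DU0 : D n <= U0.
    have : U <= U0 by rewrite /U ler_piMl// ltW.
    by have := K_ge0 n; lra.
  have [|||k k_inj hk] := rigid (alpha n)
    (fun r => cumulant P (F n) r / cumulant P (W 0%N) r) (Delta aoo (alpha n))
    (alpha_sqr n) _ (partial n).
  - move=> r rq.
    apply: (iid_sum_power_sums W_iid W_mom W_mean (alpha_sqr n) (F_sum n));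
      last exact: kap_neq0.
    exact: idx_gt0.
  - by rewrite -D_sqr lerXn2r ?nnegrE// ltW.
  - move=> r rq; have kr0 := kap_neq0 r rq.
    have -> : \sum_i aoo i ^+ r = cumulant P Foo r / cumulant P (W 0%N) r.
      rewrite FooE cumulant_lincomb ?idx_gt0//.
      by rewrite big_map big_enum /= mulrC mulKf.
    rewrite -mulrBl normrM normfV ler_pdivrMr ?normr_gt0//.
    have mk : m <= `|cumulant P (W 0%N) r|.
      have := m_le (Ordinal (idx_lt r rq)); rewrite /= idx_sub//.
      by rewrite /kap -(iid_cumulant W_iid W_mom) (negbTE kr0).
    apply: (@le_trans _ _ (K n)).
      have rI : r \in index_iota 2 q.+2 by rewrite mem_index_iota.
      rewrite /K (bigD1_seq r)//= ?iota_uniq// lerDl.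
      by apply: sumr_ge0.
    apply: (@le_trans _ _ U); first by have := D_ge0 n; lra.
    by rewrite /U mulrC ler_wpM2l// ltW.
  have [G_mom G_dist] := iid_sum_dist W_iid W_mom W_mean W_var
    (alpha_sqr n) (F_sum n) k_inj hk.
  eexists; split; last by rewrite exprMn D_sqr sqr_sqrtr ?(ltW c_gt0)//; exact: G_dist.
    rewrite FooE; apply: same_law_lincomb => //.
      by rewrite /unzip1 -map_comp map_inj_uniq ?enum_uniq.
    by rewrite /unzip2 -!map_comp.
  exact: all_moments_sqrB.
have sharp n : D n + K n <= U -> (wasserstein2 (F n) Foo <= (C * D n)%:E)%E.
  move=> /coupling[G [GF iFG FG]]; apply: wasserstein2_le GF FG => //.
  by rewrite mulr_ge0// ltW.
have coarse n : (wasserstein2 (F n) Foo <= 2%:E)%E.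
  apply: (wasserstein2_le (Y := Foo)) => //; first exact: all_moments_sqrB.
  have F2 := F_mom n 2%N; have Foo2 := Foo_mom 2%N.
  (* Both second moments are 1, so the bound is 4, the square of 2. *)
  apply: (@le_trans _ _ (2 * moment P (F n) 2 + 2 * moment P Foo 2)).
    rewrite !momentE -Rintegral_linD//; apply: le_Rintegral => //.
    - exact: all_moments_sqrB.
    - by apply: real_integrableD; exact: real_integrableZ.
    - move=> w _; have := sqr_ge0 (F n w + Foo w); rewrite sqrrB sqrrD; lra.
  rewrite (iid_sum_moment2 W_iid W_mom W_mean W_var (alpha_sqr n) (F_sum n)).
  rewrite FooE moment2_lincomb// big_map big_enum /= aoo_sqr; lra.
have DK_small : Delta aoo (alpha n) @[n --> \oo] --> (0 : R) ->
    (forall r : nat, (2 <= r <= q.+1)%N ->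
      cumulant P (F n) r @[n --> \oo] --> cumulant P Foo r) ->
    \forall n \near \oo, D n + K n <= U.
  move=> D0 K0.
  have D0' : D n @[n --> \oo] --> (0 : R).
    rewrite -[X in _ --> X]sqrtr0; apply: continuous_cvg => //.
    exact: sqrt_continuous.
  have K0' : K n @[n --> \oo] --> (0 : R).
    have -> : K = fun n => \sum_(r <- index_iota 2 q.+2 | r \in index_iota 2 q.+2)
        `|cumulant P (F n) r - cumulant P Foo r|.
      by apply/funext => n; rewrite /K big_seq.
    have sum0 : \sum_(r <- index_iota 2 q.+2 | r \in index_iota 2 q.+2) (0 : R) = 0.
      by rewrite big1.
    rewrite -[X in _ --> X]sum0; apply: cvg_sumr => r; rewrite mem_index_iota => rq.
    rewrite -[X in _ --> X](normr0 R) -(subrr (cumulant P Foo r)).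
    by apply: cvg_norm; apply: cvgB; [exact: K0|exact: cvg_cst].
  have DK0 : D n + K n @[n --> \oo] --> (0 : R).
    by rewrite -[X in _ --> X]addr0; exact: cvgD.
  move/cvgrPdist_le : DK0 => /(_ U U_gt0).
  apply: filterS => n; rewrite sub0r normrN; apply: le_trans; exact: ler_norm.
split=> [n|//|D0 K0].
- have [DKU|UDK] := leP (D n + K n) U.
    apply: (le_trans (sharp n DKU)); rewrite lee_fin.
    apply: ler_pM => //; [exact: ltW| |by have := K_ge0 n; lra].
    by rewrite lerDl divr_ge0// ltW.
  apply: (le_trans (coarse n)); rewrite lee_fin mulrDl ler_wpDl//.
    by rewrite mulr_ge0 ?addr_ge0// ltW.
  by rewrite mulrAC ler_pdivlMr// ler_wpM2l// ltW.
- have near_U := DK_small D0 K0; split => //.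
    by apply: filterS near_U => n; exact: sharp.
  apply: (@cvg_in_distribution_coupling _ _ _ _ _ _ (fun n => (C * D n) ^+ 2)).
    have -> : (fun n => (C * D n) ^+ 2) = (fun n => C ^+ 2 * Delta aoo (alpha n)).
      by apply/funext => n; rewrite exprMn D_sqr.
    have : C ^+ 2 * Delta aoo (alpha n) @[n --> \oo] --> C ^+ 2 * 0 by exact: cvgMr.
    by rewrite mulr0.
  by apply: filterS near_U => n; exact: coupling.
Qed.
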